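(* Let $\mathcal{F}$ be a differentially closed field of characteristic $0$. Let $S$ be a differential algebra over $\mathcal{F}$ with no zero divisors and let $R\subset S$ be a differential $\mathcal{F}$-subalgebra, both $S$ and $R$ being differentially finitely generated over $\mathcal{F}$. Suppose that there exists a non-zero element $b$ of $S$ such that every homomorphism $\varphi : R \to \mathcal{F}$ of differential algebras over $\mathcal{F}$ has only finitely many extensions to a homomorphism $\psi : S \to \mathcal{F}$ of differential algebras over $\mathcal{F}$ satisfying $\psi(b)\neq 0$. Then the field extension $\mathrm{Fract}\,S \supset \mathrm{Fract}\,R$ is finite. In particular, if $d$ is a non-negative integer such that every homomorphism $\varphi : R\to\mathcal{F}$ has at most $d$ extensions $\psi : S\to\mathcal{F}$ with $\psi(b)\neq 0$, then the degree of $\mathrm{Fract}\,S$ over $\mathrm{Fract}\,R$ is at most $d$.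
   Context: All algebras are commutative, associative and unital. A differential algebra is an algebra over a field equipped with a fixed derivation $\delta$ (a single derivation); a differential field is a field with a fixed derivation. A differential algebra over a differential field $\mathcal{F}$ is an $\mathcal{F}$-algebra with a derivation extending that of $\mathcal{F}$ (i.e. the structure map from $\mathcal{F}$ commutes with the derivations). Homomorphisms of differential algebras over $\mathcal{F}$ are $\mathcal{F}$-algebra homomorphisms commuting with the derivations; differential subalgebras are $\delta$-stable subalgebras. A differential algebra $S$ is differentially generated by $x_1,\dots,x_n$ over a differential subalgebra $R$ if the algebra $S$ is generated by $R$ together with all derivatives $\delta^k x_i$, $1\le i\le n$, $k\ge 0$; it is differentially finitely generated over $R$ if such a finite family exists. $\mathrm{Fract}\,R$ denotes the field of fractions of a differential algebra $R$ with no zero divisors. For a differential field $\mathcal{F}$, $\mathcal{F}\{y\}$ is the algebra of differential polynomials, i.e. the polynomial algebra $\mathcal{F}[y^{(k)}, k\ge 0]$ (with $y=y^{(0)}$) with the derivation extending that of $\mathcal{F}$ and satisfying $\delta(y^{(k)})=y^{(k+1)}$. For $A\in\mathcal{F}\{y\}$ and $\alpha\in\mathcal{F}$, $A(\alpha)$ is obtained by substituting $\delta^k\alpha$ for $y^{(k)}$ for all $k$. For $A\in \mathcal{F}\{y\}\setminus\mathcal{F}$ the order $\mathrm{ord}\,A$ is the largest $r$ such that $y^{(r)}$ is present in $A$; elements of $\mathcal{F}$ are regarded as having order $-\infty$, less than the order of any element of $\mathcal{F}\{y\}\setminus\mathcal{F}$. A differential field $\mathcal{F}$ is called differentially closed if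 for any $A,B\in\mathcal{F}\{y\}$ with $B\ne 0$ and $\mathrm{ord}\,B<\mathrm{ord}\,A$ there exists $\alpha\in\mathcal{F}$ such that $A(\alpha)=0$ and $B(\alpha)\neq 0$. *)

(* Defs.v *)
From HB Require Import structures.
From mathcomp Require Import all_boot all_order all_algebra finmap.
From mathcomp.multinomials Require Import monalg.
From mathcomp Require Import boolp classical_sets functions cardinality.

Set Implicit Arguments.
Unset Strict Implicit.
Unset Printing Implicit Defensive.

Import GRing.Theory.
Local Open Scope ring_scope.

Definition is_derivation (A : comNzRingType) (dA : A -> A) : Prop :=
  (forall x y, dA (x + y) = dA x + dA y) /\
  (forall x y, dA (x * y) = dA x * y + x * dA y).

(* A commutative F-algebra is a commutative ring A with a structure map
   iA : F -> A; a differential one carries moreover a derivation dA for which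
   the structure map commutes with the derivations. *)
Definition is_diff_algebra (F : fieldType) (dF : F -> F)
    (A : comNzRingType) (iA : {rmorphism F -> A}) (dA : A -> A) : Prop :=
  is_derivation dA /\ (forall a, iA (dF a) = dA (iA a)).

Definition is_diff_alg_hom (F : fieldType) (A B : comNzRingType)
    (iA : F -> A) (dA : A -> A) (iB : F -> B) (dB : B -> B) (f : A -> B) : Prop :=
  [/\ zmod_morphism f, monoid_morphism f,
      forall a, f (iA a) = iB a &
      forall x, f (dA x) = dB (f x)].

(* A is the smallest subring containing the image of F and the derivatives of
   finitely many elements.  Letting P range over boolean predicates is no
   restriction, as excluded middle is available. *)
Definition diff_finitely_generated (F : fieldType) (A : comNzRingType)
    (iA : F -> A) (dA : A -> A) : Prop :=
  exists (n : nat) (x : 'I_n -> A),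
    forall P : {pred A}, GRing.subring_closed P ->
      (forall a, iA a \in P) ->
      (forall (i : 'I_n) (k : nat), iter k dA (x i) \in P) ->
      forall s, s \in P.

(* The polynomial algebra F[y^(k), k >= 0]: a monomial m : {cmonom nat} is the
   product of the (y^(k))^(m k).  The derivation of F{y} intervenes neither in
   substitution nor in the order. *)
Notation diff_poly F := {malg F[{cmonom nat}]}.

Definition diff_eval (F : fieldType) (dF : F -> F) (A : diff_poly F) (alpha : F)
    : F :=
  mmap idfun
    (fun m : {cmonom nat} => \prod_(k <- finsupp m) iter k dF alpha ^+ m k) A.

(* The order shifted by one: 0 stands for -oo (elements of F), and r.+1 for
   order r. *)
Definition diff_ord1 (F : fieldType) (A : diff_poly F) : nat :=
  \max_(m <- msupp A) \max_(k <- finsupp m) k.+1.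

Definition differentially_closed (F : fieldType) (dF : F -> F) : Prop :=
  forall A B : diff_poly F, B != 0 -> (diff_ord1 B < diff_ord1 A)%N ->
    exists alpha : F, diff_eval dF A alpha = 0 /\ diff_eval dF B alpha != 0.

(* L viewed as a K-vector space through a field embedding K -> L. *)
Definition ext_space (K L : fieldType) (f : {rmorphism K -> L}) : Type := L.

Section ExtSpace.
Variables (K L : fieldType) (f : {rmorphism K -> L}).

HB.instance Definition _ := GRing.Zmodule.copy (ext_space f) L.

Definition ext_scale (a : K) (x : ext_space f) : ext_space f := f a * (x : L).

Fact ext_scaleA a b x : ext_scale a (ext_scale b x) = ext_scale (a * b) x.
Proof. by rewrite /ext_scale rmorphM mulrA. Qed.

Fact ext_scale1 : left_id 1 ext_scale.
Proof. by move=> x; rewrite /ext_scale rmorph1 mul1r. Qed.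

Fact ext_scaleDr : right_distributive ext_scale +%R.
Proof. by move=> a x y; rewrite /ext_scale mulrDr. Qed.

Fact ext_scaleDl x : {morph ext_scale^~ x : a b / a + b}.
Proof. by move=> a b; rewrite /ext_scale rmorphD mulrDl. Qed.

HB.instance Definition _ := GRing.Zmodule_isLmodule.Build K (ext_space f)
  ext_scaleA ext_scale1 ext_scaleDr ext_scaleDl.

End ExtSpace.

Definition has_ext_degree (K L : fieldType) (f : {rmorphism K -> L}) (n : nat)
    : Prop :=
  inhabited (Vector.axiom n (ext_space f)).

Definition finite_extension (K L : fieldType) (f : {rmorphism K -> L}) : Prop :=
  exists n, has_ext_degree f n.

Definition ext_degree_le (K L : fieldType) (f : {rmorphism K -> L}) (d : nat)
    : Prop :=
  exists2 n, (n <= d)%N & has_ext_degree f n.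

Section FractInclusion.
Variables (S : idomainType) (P : pred S) (R : subIdomainType P).

(* The embedding Fract R -> Fract S induced by an inclusion R -> S. *)
Definition fract_incl (x : {fraction R}) : {fraction S} :=
  FracField.tofrac (val (\n_(repr x))) / FracField.tofrac (val (\d_(repr x))).

Let tf := @FracField.tofrac S.

Let fract_rep (x : {fraction R}) : exists n d : R,
  [/\ d != 0, x = FracField.tofrac n / FracField.tofrac d &
      fract_incl x = tf (val n) / tf (val d)].
Proof.
exists (\n_(repr x)), (\d_(repr x)); split=> //.
  exact: denom_ratioP.
have d0 := denom_ratioP (repr x).
rewrite -{1}[x]reprK.
apply: (canRL (mulfK _)); first by rewrite tofrac_eq0.
unlock FracField.tofrac; rewrite -[LHS]FracField.pi_mul.
apply/eqmodP; rewrite /= FracField.equivfE /FracField.mulf.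
by rewrite !numden_Ratio ?mulf_neq0 ?oner_neq0 // !mulr1 mulrC.
Qed.

Let val_neq0 (d : R) : d != 0 -> tf (val d) != 0.
Proof. by rewrite /tf tofrac_eq0 -(inj_eq val_inj) rmorph0. Qed.

Lemma fract_incl_frac (n d : R) : d != 0 ->
  fract_incl (FracField.tofrac n / FracField.tofrac d)
  = FracField.tofrac (val n) / FracField.tofrac (val d).
Proof.
move=> d0; have [n' [d' [d'0 e ->]]] := fract_rep (FracField.tofrac n / FracField.tofrac d).
move/eqP: e; rewrite eqr_div ?tofrac_eq0 // -!tofracM tofrac_eq => /eqP e.
apply/eqP; rewrite eqr_div ?val_neq0 // /tf -!tofracM tofrac_eq -!rmorphM.
by rewrite /= -e.
Qed.

Fact fract_incl_zmod_morphism : zmod_morphism fract_incl.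
Proof.
move=> x y.
have [a [b [b0 -> ->]]] := fract_rep x; have [c [d [d0 -> ->]]] := fract_rep y.
rewrite -!mulNr addf_div ?tofrac_eq0 // -tofracN -!tofracM -tofracD.
rewrite fract_incl_frac ?mulf_neq0 // addf_div ?val_neq0 //.
by rewrite /tf !(rmorphD, rmorphM, rmorphN).
Qed.

Fact fract_incl_monoid_morphism : monoid_morphism fract_incl.
Proof.
split.
  have -> : 1 = FracField.tofrac 1 / FracField.tofrac 1 :> {fraction R}.
    by rewrite tofrac1 divr1.
  by rewrite fract_incl_frac ?oner_neq0 // rmorph1 tofrac1 divr1.
move=> x y.
have [a [b [b0 -> ->]]] := fract_rep x; have [c [d [d0 -> ->]]] := fract_rep y.
rewrite mulf_div -!tofracM fract_incl_frac ?mulf_neq0 // mulf_div.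
by rewrite /tf !(rmorphM, tofracM).
Qed.

HB.instance Definition _ := GRing.isZmodMorphism.Build
  {fraction R} {fraction S} fract_incl fract_incl_zmod_morphism.
HB.instance Definition _ := GRing.isMonoidMorphism.Build
  {fraction R} {fraction S} fract_incl fract_incl_monoid_morphism.

End FractInclusion.

Arguments fract_incl {S P} R x.

(* The extensions psi : S -> F of phi : R -> F with psi b != 0; homomorphisms
   are bare functions, so that this is a set of functions. *)
Definition extensions (F : fieldType) (dF : F -> F)
    (S : idomainType) (iS : F -> S) (dS : S -> S)
    (P : pred S) (R : subIdomainType P) (b : S) (phi : R -> F) : set (S -> F) :=
  [set psi : S -> F |
     [/\ is_diff_alg_hom iS dS id dF psi,
         forall r : R, psi (val r) = phi r & psi b != 0]]%classic.

(* Main.v *)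
Require Import Defs.
From HB Require Import structures.
From mathcomp Require Import all_boot all_order all_algebra finmap zify ring.
From mathcomp Require Import separable.
From mathcomp.multinomials Require Import monalg.
From mathcomp Require Import boolp classical_sets functions cardinality.
Set Implicit Arguments.
Unset Strict Implicit.
Unset Printing Implicit Defensive.
Import GRing.Theory.
Local Open Scope ring_scope.

(** Write R{x} for the differential subring of S generated by R and one element
x, and call a map R{y} -> F evaluation at alpha when it substitutes the
derivatives of alpha for those of y after applying a given phi : R -> F to the
coefficients.

Both assertions count extensions of a well chosen phi : R -> F.  The engine is
the generic extension theorem [differential_extension]: if S is differentially
generated over R by finitely many elements and b <> 0, then some a <> 0 in R is
such that every phi with phi a <> 0 extends to psi : S -> F with psi b <> 0.
By induction it suffices to add one generator x, and to know which alpha in F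
make x |-> alpha a legitimate extension of phi.

- If x satisfies no differential equation over R, every alpha is legitimate.
- Otherwise let r be the least order of an equation of x, and A an equation of
  order r and of least degree in the r-th derivative.  Modulo powers of the
  separant of A, every differential polynomial reduces to one of order at most
  r ([separant_reduction]); modulo powers of the initial of A, those that vanish
  at x reduce to 0 ([min_annihilator_specialize]).  Hence alpha is legitimate as
  soon as it is a zero of A at which initial and separant do not vanish.  A norm
  ([min_annihilator_norm]) turns that condition, and the condition psi b <> 0,
  into the non-vanishing of a single G of order less than r
  ([min_annihilator_regular]).  This is exactly the situation in which a
  differentially closed field provides a zero.

When x is transcendental over R, either r > 0 or there is no equation, and then
G may be multiplied by (y - alpha_1)...(y - alpha_n): there are infinitely many
legitimate alpha ([transcendental_specializations]).  So finiteness of the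
fibres makes every x in S algebraic over R.  In characteristic 0 a single
element z of S then generates the field extension ([primitive_generator]; the
derivatives of the generators come for free by [hull_der]), and the degree e of
Fract S over Fract R is the degree of the least equation A of z
([hull_ext_degree]).

When x = z is algebraic, r = 0 and G lies in R.  If phi G <> 0 then all roots of
the image of A under phi are simple, there are e of them because F is
algebraically closed, and each one gives an extension of phi
([algebraic_specializations]).  Hence e <= d. *)

(** * Subrings and induced homomorphisms *)

Section SubringType.
Variables (B : comNzRingType) (P : {pred B}).

(** Carrying the closure proof in the predicate lets the ring structure of the
subtype be inferred from the predicate alone. *)
Definition subring_pred (clP : GRing.subring_closed P) : {pred B} := P.

Variable clP : GRing.subring_closed P.
HB.instance Definition _ :=
  GRing.isSubringClosed.Build B (subring_pred clP) clP.

Definition subring_of : Type := {x : B | subring_pred clP x}.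
HB.instance Definition _ := SubChoice.on subring_of.
HB.instance Definition _ := [SubChoice_isSubComNzRing of subring_of by <:].
End SubringType.

Lemma rmorphism_of (A B : nzRingType) (f : A -> B) :
  zmod_morphism f -> monoid_morphism f -> exists g : {rmorphism A -> B}, g =1 f.
Proof.
move=> fB fM.
pose g : {rmorphism A -> B} := HB.pack f (GRing.isZmodMorphism.Build A B f fB)
  (GRing.isMonoidMorphism.Build A B f fM).
by exists g.
Qed.

(** This is how homomorphisms out of R{x} are built: D is the ring R{y}, g is
evaluation at x, v is the inclusion of R{x}, and f is evaluation at alpha. *)
Lemma factor_rmorphism (D A B T : nzRingType) (g : {rmorphism D -> B})
    (v : {rmorphism A -> B}) (f : {rmorphism D -> T}) :
  injective v -> (forall y, exists p, v y = g p) ->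
  (forall p, g p = 0 -> f p = 0) ->
  exists h : {rmorphism A -> T}, forall y p, v y = g p -> h y = f p.
Proof.
move=> vI /choice[l lE] ker.
have wd p q : g p = g q -> f p = f q.
  move=> e; apply/eqP; rewrite -subr_eq0 -rmorphB; apply/eqP/ker.
  by rewrite rmorphB e subrr.
have [||h hE] := @rmorphism_of A T (f \o l).
- move=> y z /=; rewrite -rmorphB; apply: wd.
  by rewrite -lE !rmorphB /= !lE.
- split=> [|y z] /=; first by rewrite -(rmorph1 f); apply: wd; rewrite -lE !rmorph1.
  by rewrite -rmorphM; apply: wd; rewrite -lE !rmorphM /= !lE.
by exists h => y p e; rewrite hE /=; apply: wd; rewrite -lE.
Qed.

(** * Differential polynomials *)

(** Constants and variables are locked, as comparing finitely supported functions
up to conversion is very costly. *)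
HB.lock Definition dconst (R : comNzRingType) : {rmorphism R -> diff_poly R} :=
  [the {rmorphism R -> diff_poly R} of (fun c : R => c%:MP : diff_poly R)].
Local Notation "c %:DP" := (dconst _ c) (at level 2, format "c %:DP").

HB.lock Definition dvar (R : comNzRingType) (k : nat) : diff_poly R := << ucm k >>.

Local Notation "''Y_' k" := (dvar _ k) (at level 8, k at level 2, format "''Y_' k").

Section Deval.
Variables (T : comNzRingType) (u : nat -> T).

(** The shape of [diff_eval] on monomials, for an arbitrary sequence u. *)
Definition mon_eval (m : {cmonom nat}) : T := \prod_(k <- finsupp m) u k ^+ m k.

Lemma mon_evalEw (d : {fset nat}) (m : {cmonom nat}) : (finsupp m `<=` d)%fset ->
  mon_eval m = \prod_(k <- d) u k ^+ m k.
Proof.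
move=> le; rewrite [LHS](big_fset_incl _ le) => //= k _.
by rewrite -cmE_eq0 => /eqP->; rewrite expr0.
Qed.

Lemma mon_eval_mmorphism : mmorphism mon_eval.
Proof.
split=> [m n|]; last by rewrite /mon_eval mdom1 big_seq_fset0.
rewrite (@mon_evalEw (finsupp m `|` finsupp n)%fset) ?mdomD //.
rewrite (@mon_evalEw (finsupp m `|` finsupp n)%fset m) ?fsubsetUl //.
rewrite (@mon_evalEw (finsupp m `|` finsupp n)%fset n) ?fsubsetUr //.
by rewrite -big_split; apply: eq_bigr => k _ /=; rewrite cmM exprD.
Qed.
HB.instance Definition _ := isMultiplicative.Build _ T mon_eval mon_eval_mmorphism.

Variables (R : comNzRingType) (h : {rmorphism R -> T}).
Definition deval (p : diff_poly R) : T := mmap h mon_eval p.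
HB.instance Definition _ := GRing.RMorphism.copy deval (mmap h mon_eval).

Lemma deval_const c : deval c%:DP = h c.
Proof. rewrite dconst.unlock; exact: mmapC. Qed.

Lemma deval_var k : deval 'Y_k = u k.
Proof.
by rewrite dvar.unlock /deval mmapU /= rmorph1 mul1r /mon_eval mdomU big_seq_fset1 cmUU.
Qed.
End Deval.

Lemma monomU_exp (R : comNzRingType) k n :
  << iterop n mmul (ucm k) mone >> = ('Y_k : diff_poly R) ^+ n.
Proof.
elim: n => [|n IH]; first by rewrite expr0.
rewrite exprS -IH dvar.unlock malgM_def fgmulUU mulr1; congr << _ >>.
by case: {IH} n => //=; rewrite mulm1.
Qed.

Lemma iterop_ucmE k n i : (iterop n mmul (ucm k) mone : {cmonom nat}) i = ((k == i) * n)%N.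
Proof.
elim: n => [|n IH]; first by rewrite muln0 /= cm1.
case: n IH => [|n] IH; first by rewrite muln1 /= cmU.
rewrite -[iterop _ _ _ _]/(mmul (ucm k) (iterop n.+1 mmul (ucm k) mone)).
by rewrite cmM IH cmU -mulnS.
Qed.

Lemma mon_evalY (R : comNzRingType) m :
  mon_eval (fun k => 'Y_k) m = << m >> :> diff_poly R.
Proof.
have -> : mon_eval (fun k => 'Y_k) m =
    << \big[mmul/mone]_(k <- finsupp m) iterop (m k) mmul (ucm k) mone >> :> diff_poly R.
  rewrite /mon_eval; elim: (enum_fset (finsupp m)) => [|k s IH].
    by rewrite !big_nil.
  rewrite big_cons IH -(monomU_exp R k (m k)) malgM_def fgmulUU mulr1.
  by congr << _ >>; rewrite big_cons.
congr << _ >>; apply/eqP/cmP => i.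
rewrite (big_morph (fun n : {cmonom nat} => n i) (id1 := 0%N) (op1 := addn)); first last.
- exact: cm1.
- by move=> a b; rewrite cmM.
under eq_bigr do rewrite iterop_ucmE.
have [im|im] := boolP (i \in finsupp m).
  rewrite (big_fsetD1 i) //= eqxx mul1n big_seq big1 ?addn0 // => k.
  by rewrite !inE => /andP[/negPf->].
rewrite big_seq big1; first by move: im; rewrite -cmE_eq0 => /eqP.
by move=> k km; case: eqP => [ki|//]; rewrite -ki km in im.
Qed.

Lemma dconst_monom (R : comNzRingType) c m :
  c%:DP * mon_eval (dvar R) m = << c *g m >> :> diff_poly R.
Proof.
rewrite dconst.unlock mul_malgC; apply/malgP => n; rewrite mcoeffZ mcoeffU.
by rewrite mon_evalY mcoeffU mulrnAr mulr1.
Qed.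

Lemma dconst_inj (R : comNzRingType) : injective (dconst R).
Proof. by rewrite dconst.unlock; apply: can_inj; exact: malgCK. Qed.

Section Order.
Variable R : comNzRingType.
Implicit Types p q : diff_poly R.

Definition ord_lt r : {pred diff_poly R} :=
  fun p => all (fun m : {cmonom nat} => all (fun k => (k < r)%N) (finsupp m)) (msupp p).

Lemma ord_ltP r p :
  reflect (forall m, m \in msupp p -> forall k, k \in finsupp m -> (k < r)%N)
          (p \in ord_lt r).
Proof.
apply: (iffP allP) => [H m mp k km|H m mp]; first exact: (allP (H m mp)).
by apply/allP => k; apply: H.
Qed.

Lemma ord_lt_subring r : GRing.subring_closed (ord_lt r).
Proof.
split.
- apply/ord_ltP => m; rewrite -mcoeff_neq0 mcoeff1.
  by case: (m =P mone) => [-> _ k|_]; rewrite ?mdom1 ?eqxx.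
- move=> p q /ord_ltP hp /ord_ltP hq; apply/ord_ltP => m.
  by move/(fsubsetP (msuppB_le _ _)); rewrite in_fsetU => /orP[/hp|/hq].
- move=> p q /ord_ltP hp /ord_ltP hq; apply/ord_ltP => m.
  move/msuppM_le=> [m1 [m2 [/hp h1 /hq h2 ->]]] k.
  by rewrite mdomD in_fsetU => /orP[/h1|/h2].
Qed.
HB.instance Definition _ r :=
  GRing.isSubringClosed.Build (diff_poly R) (ord_lt r) (ord_lt_subring r).

Lemma ord_ltC r c : c%:DP \in ord_lt r.
Proof.
rewrite dconst.unlock; apply/ord_ltP => m /(fsubsetP msuppU_le).
by rewrite in_fset1 => /eqP ->; rewrite mdom1.
Qed.

Lemma ord_ltX r k : (k < r)%N -> 'Y_k \in ord_lt r.
Proof.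
rewrite dvar.unlock => kr; apply/ord_ltP => m /(fsubsetP msuppU_le).
rewrite in_fset1 => /eqP -> i.
by rewrite mdomU in_fset1 => /eqP->.
Qed.

Lemma ord_ltS r s p : (r <= s)%N -> p \in ord_lt r -> p \in ord_lt s.
Proof.
by move=> rs /ord_ltP hp; apply/ord_ltP => m mp k km; apply: leq_trans (hp _ mp _ km) rs.
Qed.

Lemma ord_lt_bound p : exists r, p \in ord_lt r.
Proof.
exists (\max_(m <- msupp p) \max_(k <- finsupp m) k.+1)%N.
apply/ord_ltP => m mp k km.
apply: leq_trans (leq_bigmax_seq _ mp isT); exact: leq_bigmax_seq km isT.
Qed.

(** Properties of differential polynomials of order less than r are proved below
by closure under the ring operations, never on coefficients. *)
Lemma diff_poly_ind r (Q : diff_poly R -> Prop) :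
  (forall c, Q c%:DP) -> (forall k, (k < r)%N -> Q 'Y_k) ->
  (forall p q, Q p -> Q q -> Q (p + q)) -> (forall p q, Q p -> Q q -> Q (p * q)) ->
  forall p, p \in ord_lt r -> Q p.
Proof.
move=> QC QX QD QM p /ord_ltP hp; rewrite [p]monalgE big_seq.
apply: (big_ind Q) => [||m mp]; [by rewrite -(rmorph0 (dconst R)); apply: (QC)|exact: QD|].
rewrite -dconst_monom.
apply: (QM); first exact: QC.
rewrite /mon_eval big_seq; apply: (big_ind Q) => [||k km].
- by rewrite -(rmorph1 (dconst R)); apply: (QC).
- exact: QM.
- elim: (m k) => [|n IH]; first by rewrite expr0 -(rmorph1 (dconst R)); apply: (QC).
  by rewrite exprS; apply: (QM) => //; apply: QX; apply: hp km.
Qed.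
End Order.

(** * Minimal annihilating polynomials *)

Section PseudoReduction.
Variable E : comNzRingType.
Implicit Types A B C : {poly E}.

Definition pseudo_red A B :=
  lead_coef A *: B - lead_coef B *: ('X^(size B - size A) * A).

(** The two leading terms cancel. *)
Lemma size_pseudo_red A B :
  A != 0 -> (size A <= size B)%N -> (size (pseudo_red A B) < size B)%N.
Proof.
rewrite -size_poly_gt0 => A0 AB; have B0 := leq_trans A0 AB.
rewrite -(prednK B0) ltnS; apply/leq_sizeP => j jB.
rewrite coefB !coefZ coefXnM.
have -> : (j < size B - size A)%N = false by apply/negbTE; lia.
have [->|jB'] := eqVneq j (size B).-1.
  have -> : ((size B).-1 - (size B - size A))%N = (size A).-1 by lia.
  by rewrite -!lead_coefE mulrC subrr.
have Bj : (size B <= j)%N by move/eqP: jB'; lia.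
rewrite (nth_default _ Bj) nth_default ?mulr0 ?subr0 //.
move: (size A) (size B) AB Bj => a c; lia.
Qed.

(** Euclidean division without inverting the leading coefficient of C.  The size
bound on the quotient is what makes minimality applicable to it. *)
Lemma pseudo_div C : (1 < size C)%N -> forall A, exists k Q M,
  [/\ lead_coef C ^+ k *: A = Q * C + M, (size M < size C)%N &
      (size Q <= (size A).-1)%N].
Proof.
move=> C1 A; have [n] := ubnP (size A); elim: n A => // n IH A.
have C0 : C != 0 by rewrite -size_poly_gt0; lia.
rewrite ltnS => An; have [AC|CA] := ltnP (size A) (size C).
  by exists 0%N, 0, A; rewrite expr0 scale1r mul0r add0r size_poly0.
have sr := size_pseudo_red C0 CA.
have [|k [Q [M [eQ sM sQ]]]] := IH (pseudo_red C A); first lia.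
exists k.+1, (Q + (lead_coef C ^+ k * lead_coef A) *: 'X^(size A - size C)), M.
split=> //.
  rewrite mulrDl addrAC -eQ /pseudo_red scalerBr !scalerA -exprSr.
  by rewrite -scalerAl subrK.
apply: leq_trans (size_polyD _ _) _; rewrite geq_max; apply/andP; split; first lia.
by apply: leq_trans (size_scale_leq _ _) _; rewrite size_polyXn; lia.
Qed.
End PseudoReduction.

(** This replaces the minimal polynomial of xi over the field of fractions of E,
with denominators cleared: all statements then remain inside E, where a
homomorphism to another field can be applied. *)
Definition min_annihilator (E S : nzRingType) (e : E -> S) (xi : S) (A : {poly E}) :=
  [/\ A != 0, root (map_poly e A) xi &
      forall B, B != 0 -> root (map_poly e B) xi -> (size A <= size B)%N].

Section MinAnnihilator.
Variables (E : comNzRingType) (S : idomainType) (e : {rmorphism E -> S}).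
Hypothesis e_inj : injective e.
Variables (xi : S) (A : {poly E}).
Hypothesis Amin : min_annihilator e xi A.
Implicit Types B C : {poly E}.

Let ev B := (map_poly e B).[xi].

Let e0 a : (e a == 0) = (a == 0).
Proof. by rewrite -(inj_eq e_inj) rmorph0. Qed.

Let evA : ev A = 0.
Proof. by case: Amin => _ /rootP. Qed.

Let A_neq0 : A != 0.
Proof. by case: Amin. Qed.

Lemma min_annihilator_size B : root (map_poly e B) xi -> (size B < size A)%N -> B = 0.
Proof.
case: Amin => _ _ Am rB; rewrite ltnNge; apply: contraNeq => B0; exact: Am.
Qed.

Lemma ev_pseudo_red B : ev (pseudo_red A B) = e (lead_coef A) * ev B.
Proof.
rewrite /ev rmorphB /= !map_polyZ /= rmorphM /= hornerD hornerN !hornerZ hornerM.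
by rewrite -/(ev A) evA !mulr0 subr0.
Qed.

(** Multiplying B by the leading coefficient of A and subtracting a multiple of A
lowers its degree without affecting its vanishing at xi or at beta.  As A is
minimal, this ends with the zero polynomial, which vanishes at beta. *)
Lemma min_annihilator_specialize (F : idomainType) (h : {rmorphism E -> F})
    (beta : F) : h (lead_coef A) != 0 -> root (map_poly h A) beta ->
  forall B, root (map_poly e B) xi -> root (map_poly h B) beta.
Proof.
move=> hI /rootP hA B; have [n] := ubnP (size B); elim: n B => // n IH B.
rewrite ltnS => Bn rB; have [BA|AB] := ltnP (size B) (size A).
  by rewrite (min_annihilator_size rB BA) rmorph0 root0.
have sr := size_pseudo_red A_neq0 AB.
have /IH : (size (pseudo_red A B) < n)%N by apply: leq_trans sr Bn.
have -> : root (map_poly e (pseudo_red A B)) xi.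
  by apply/rootP; rewrite -/(ev _) ev_pseudo_red [ev B](rootP rB) mulr0.
move=> /(_ isT)/rootP; rewrite rmorphB /= !map_polyZ /= rmorphM /= hornerD hornerN.
rewrite !hornerZ hornerM hA !mulr0 subr0 => /eqP; rewrite mulf_eq0 (negPf hI).
by move=> /= /eqP ?; apply/rootP.
Qed.

(** A stand-in for the norm of C(xi).  Reducing C modulo A and then running the
Euclidean algorithm on A and C lowers the degree of C until it is a constant.
The algorithm cannot stop earlier: a vanishing remainder would make the quotient
an annihilator of degree less than that of A. *)
Lemma min_annihilator_norm C : ~~ root (map_poly e C) xi ->
  exists2 G : E, G != 0 & exists U, e G = (map_poly e U).[xi] * (map_poly e C).[xi].
Proof.
have [n] := ubnP (size C); elim: n C => // n IH C; rewrite ltnS => Cn rC.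
have C0 : C != 0 by apply: contraNneq rC => ->; rewrite rmorph0 root0.
have [CA|AC] := ltnP (size C) (size A); last first.
  have sr := size_pseudo_red A_neq0 AC.
  have [||G G0 [U eG]] := IH (pseudo_red A C).
  - exact: leq_trans sr Cn.
  - by rewrite rootE -/(ev (pseudo_red A C)) ev_pseudo_red mulf_neq0 // e0 lead_coef_eq0.
  exists G => //; exists (lead_coef A *: U).
  by rewrite eG -/(ev (pseudo_red A C)) ev_pseudo_red mulrCA mulrA map_polyZ hornerZ.
have [C1|C1] := leqP (size C) 1.
  exists C`_0; first by rewrite -polyC_eq0 -size1_polyC.
  by exists 1; rewrite rmorph1 hornerC mul1r {2}(size1_polyC C1) map_polyC hornerC.
have [k [Q [M [eM sM sQ]]]] := pseudo_div C1 A.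
have evM : ev M = - (ev Q * ev C).
  have := congr1 ev eM; rewrite /ev map_polyZ hornerZ -/(ev A) evA mulr0.
  rewrite rmorphD rmorphM /= hornerD hornerM => /esym/eqP.
  by rewrite addrC addr_eq0 => /eqP.
have [rM|rM] := boolP (root (map_poly e M) xi); last first.
  have [|//|G G0 [U eG]] := IH M; first exact: leq_trans sM Cn.
  exists G => //; exists (- (U * Q)).
  by rewrite eG -/(ev M) evM rmorphN rmorphM /= hornerN hornerM mulrN mulNr !mulrA.
(* The remainder vanishes, so A would be a product Q * C up to a scalar. *)
have M0 := min_annihilator_size rM (ltn_trans sM CA).
have /eqP : ev Q * ev C = 0 by apply/oppr_inj; rewrite -evM /ev (rootP rM) oppr0.
rewrite mulf_eq0 /ev -!rootE (negPf rC) orbF => rQ.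
have Q0 : Q = 0.
  apply: min_annihilator_size rQ _; apply: leq_ltn_trans sQ _.
  by rewrite prednK // size_poly_gt0.
have /eqP := congr1 (fun p : {poly E} => e p`_(size A).-1) eM.
rewrite M0 Q0 mul0r add0r coef0 coefZ -lead_coefE rmorph0 rmorphM rmorphXn /=.
by rewrite mulf_eq0 expf_eq0 !e0 !lead_coef_eq0 (negPf C0) (negPf A_neq0) andbF.
Qed.

Lemma min_annihilator_size_gt1 : (1 < size A)%N.
Proof.
rewrite ltnNge; apply/negP => A1; have := evA.
rewrite /ev (size1_polyC A1) map_polyC hornerC => /eqP; rewrite e0 => /eqP a0.
by move: A_neq0; rewrite (size1_polyC A1) a0 polyC0 eqxx.
Qed.

Lemma min_annihilator_separant : [pchar S] =i pred0 -> ~~ root (map_poly e A^`()) xi.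
Proof.
move=> S0; apply/negP => rA.
have A1 := min_annihilator_size_gt1.
have sA : (size A^`() < size A)%N by apply: lt_size_deriv.
have /(congr1 (fun p : {poly E} => p`_(size A).-2)) := min_annihilator_size rA sA.
rewrite coef_deriv coef0 => /(congr1 e)/eqP.
have -> : (size A).-2.+1 = (size A).-1 by lia.
rewrite rmorphMn rmorph0 -lead_coefE -mulr_natr mulf_eq0 e0 lead_coef_eq0.
rewrite (negPf A_neq0) /=; move/pcharf0P: S0 => ->.
by case: (size A) A1 => [|[]].
Qed.
End MinAnnihilator.

(** * Reduction modulo the separant *)

Section Derivation.
Variables (T : comNzRingType) (dT : T -> T).
Hypothesis dT_der : is_derivation dT.

Lemma derD x y : dT (x + y) = dT x + dT y. Proof. exact: dT_der.1. Qed.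
Lemma derM x y : dT (x * y) = dT x * y + x * dT y. Proof. exact: dT_der.2. Qed.
Lemma der0 : dT 0 = 0.
Proof. by apply: (addrI (dT 0)); rewrite -derD !addr0. Qed.
Lemma derN x : dT (- x) = - dT x.
Proof. by apply/eqP; rewrite -addr_eq0 -derD addNr der0. Qed.
End Derivation.

HB.lock Definition diff_eval_at (R T : comNzRingType) (dT : T -> T) (h : {rmorphism R -> T})
    (x : T) : {rmorphism diff_poly R -> T} := deval (fun k => iter k dT x) h.

Lemma diff_eval_at_const (R T : comNzRingType) (dT : T -> T) (h : {rmorphism R -> T}) x c :
  diff_eval_at dT h x c%:DP = h c.
Proof. by rewrite diff_eval_at.unlock; exact: deval_const. Qed.

Lemma diff_eval_at_var (R T : comNzRingType) (dT : T -> T) (h : {rmorphism R -> T}) x k :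
  diff_eval_at dT h x 'Y_k = iter k dT x.
Proof. by rewrite diff_eval_at.unlock; exact: deval_var. Qed.

(** In this section E is the ring of differential polynomials of order less than
r, so that a polynomial over E is one of order at most r: its variable is the
r-th derivative of y. *)
Section Models.
Variables (R : comNzRingType) (dR : R -> R).
Variables (E : comNzRingType) (iota : {rmorphism E -> diff_poly R}) (r : nat).
Hypothesis iota_ord : forall a, iota a \in ord_lt r.
Hypothesis iota_surj : forall p, p \in ord_lt r -> exists a, iota a = p.
Variable A : {poly E}.

(** A place where differential polynomials over R can be evaluated.  The reductions
below are found once and hold in all models; they are used both at x in S and at
alpha in F, where alpha depends on data that come after the reduction. *)
Record model := Model {
  mT : comNzRingType;
  mD : mT -> mT;
  mh : {rmorphism R -> mT};
  mx : mT;
  mD_der : is_derivation mD;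
  mh_diff : forall a, mh (dR a) = mD (mh a);
}.

Definition model_eval (m : model) : {rmorphism diff_poly R -> mT m} :=
  diff_eval_at (@mD m) (mh m) (mx m).
Definition model_coef (m : model) : {rmorphism E -> mT m} := model_eval m \o iota.
Definition model_poly (m : model) : {rmorphism {poly E} -> mT m} :=
  horner_eval (iter r (@mD m) (mx m)) \o map_poly (model_coef m).

Lemma model_polyC m a : model_poly m a%:P = model_eval m (iota a).
Proof. by rewrite /model_poly /= map_polyC /horner_eval hornerC. Qed.

Lemma model_polyX m : model_poly m 'X = model_eval m 'Y_r.
Proof. by rewrite /model_poly /= map_polyX /horner_eval hornerX [RHS]diff_eval_at_var. Qed.

Lemma model_evalYS m k : model_eval m 'Y_k.+1 = mD (model_eval m 'Y_k).
Proof. by rewrite (diff_eval_at_var _ _ _ k.+1) (diff_eval_at_var _ _ _ k). Qed.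

Let der_ord p : p \in ord_lt r -> exists a B, forall m,
  model_eval m p = model_poly m a%:P /\ mD (model_eval m p) = model_poly m B.
Proof.
move: p; apply: diff_poly_ind => [c|k kr|p q [a [B hp]] [b [C hq]]|p q [a [B hp]] [b [C hq]]].
- have [a ea] := iota_surj (ord_ltC r c); have [b eb] := iota_surj (ord_ltC r (dR c)).
  exists a, b%:P => m; rewrite !model_polyC ea eb; split=> //.
  by rewrite (diff_eval_at_const _ _ _ c) (diff_eval_at_const _ _ _ (dR c)) mh_diff.
- have [a ea] := iota_surj (ord_ltX R kr).
  have [kr'|kr'] := eqVneq k.+1 r.
    by exists a, 'X => m; rewrite model_polyC ea model_polyX -kr' model_evalYS.
  have [|b eb] := @iota_surj 'Y_k.+1.
    by apply: ord_ltX; rewrite ltn_neqAle kr' kr.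
  by exists a, b%:P => m; rewrite !model_polyC ea eb model_evalYS.
- exists (a + b), (B + C) => m; have [e1 e2] := hp m; have [e3 e4] := hq m.
  by rewrite (rmorphD (model_eval m)) (derD (mD_der m)) e2 e4 e1 e3 polyCD !rmorphD.
- exists (a * b), (B * b%:P + a%:P * C) => m; have [e1 e2] := hp m; have [e3 e4] := hq m.
  by rewrite (rmorphM (model_eval m)) (derM (mD_der m)) e2 e4 e1 e3 polyCM !(rmorphD, rmorphM).
Qed.

(** The chain rule, with the derivative of the highest variable split off. *)
Let der_poly B : exists Bd, forall m,
  mD (model_poly m B) = model_poly m Bd + model_poly m B^`() * model_eval m 'Y_r.+1.
Proof.
elim/poly_ind: B => [|B c [Bd eB]].
  by exists 0 => m; rewrite deriv0 !rmorph0 mul0r addr0 (der0 (mD_der m)).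
have [a [C eC]] := der_ord (iota_ord c).
exists (Bd * 'X + C) => m; have [_ ec] := eC m.
rewrite rmorphD (derD (mD_der m)) model_polyC ec rmorphM (derM (mD_der m)) eB.
rewrite derivD derivC derivM derivX mulr1 addr0 !(rmorphD, rmorphM).
rewrite !model_polyX -model_evalYS !mulrDl -!addrA; congr (_ + _).
by rewrite mulrAC [LHS]addrA addrC.
Qed.

Definition on_hypersurface m := model_poly m A = 0.

(** Differentiating A = 0 gives separant * y^(r+1) = (order at most r), so the one
variable of order r+1 in the derivative of B disappears after multiplication by
the separant. *)
Let der_sep B : exists B', forall m, on_hypersurface m ->
  model_poly m A^`() * mD (model_poly m B) = model_poly m B'.
Proof.
have [Ad eA] := der_poly A; have [Bd eB] := der_poly B.
exists (A^`() * Bd - B^`() * Ad) => m hm; have := eA m.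
rewrite hm (der0 (mD_der m)) => /esym/eqP; rewrite addrC addr_eq0 => /eqP eY.
by rewrite eB rmorphB !rmorphM mulrDr mulrCA eY mulrN.
Qed.

(** Each further derivative of y is expressed through the previous ones by
differentiating the equation A = 0; only division by the separant is needed. *)
Lemma separant_reduction p : exists k B, forall m, on_hypersurface m ->
  model_poly m A^`() ^+ k * model_eval m p = model_poly m B.
Proof.
have [n] := ord_lt_bound p.
move: p; apply: diff_poly_ind => [c|k _|p q [k [B hp]] [l [C hq]]|p q [k [B hp]] [l [C hq]]].
- have [a ea] := iota_surj (ord_ltC r c).
  by exists 0%N, a%:P => m _; rewrite model_polyC ea mul1r.
- elim: k => [|k [n' [B IH]]].
    have [r0|r0] := posnP r.
      by exists 0%N, 'X => m _; rewrite model_polyX mul1r r0.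
    have [a ea] := iota_surj (ord_ltX R r0).
    by exists 0%N, a%:P => m _; rewrite model_polyC ea mul1r.
  have [kr|kr] := ltnP k.+1 r.
    have [a ea] := iota_surj (ord_ltX R kr).
    by exists 0%N, a%:P => m _; rewrite model_polyC ea mul1r.
  have [B' eB'] := der_sep B; have [N eN] := der_sep (A^`() ^+ n').
  (* Differentiate s ^+ n' * y = B, where s is the separant,
     and multiply by s ^+ n'.+1. *)
  exists (n' + n'.+1)%N, (A^`() ^+ n' * B' - N * B) => m hm.
  rewrite rmorphB !rmorphM -eB' // -eN // -IH // rmorphXn (derM (mD_der m)).
  rewrite model_evalYS exprD exprS.
  have quotient_rule (T : comNzRingType) (t u v dv dt : T) :
      t * (u * t) * dv = t * (u * (dt * v + t * dv)) - u * dt * (t * v) by ring.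
  exact: quotient_rule.
- exists (k + l)%N, (A^`() ^+ l * B + A^`() ^+ k * C) => m hm.
  rewrite (rmorphD (model_eval m)) (rmorphD (model_poly m)).
  rewrite !(rmorphM (model_poly m)).
  rewrite !(rmorphXn (model_poly m)) -hp // -hq // mulrDr exprD !mulrA.
  by congr (_ * _ + _); rewrite mulrC.
- exists (k + l)%N, (B * C) => m hm.
  rewrite (rmorphM (model_eval m)) (rmorphM (model_poly m)).
  by rewrite -hp // -hq // exprD mulrACA.
Qed.
End Models.

(** * Regular zeros of the minimal equation *)

(** For f the evaluation at x and g the evaluation at alpha, this is the condition
under which g factors through R{x}. *)
Definition specializes (T U V : nmodType) (f : T -> U) (g : T -> V) :=
  forall p, f p = 0 -> g p = 0.

Section Specialization.
Variables (R : comNzRingType) (dR : R -> R) (S : idomainType) (dS : S -> S).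
Variables (j : {rmorphism R -> S}) (x : S).
Hypotheses (dS_der : is_derivation dS) (j_diff : forall a, j (dR a) = dS (j a)).
Hypothesis S_char0 : [pchar S] =i pred0.

Let ev := diff_eval_at dS j x.

Section OrderSplit.
Variables (E : comNzRingType) (iota : {rmorphism E -> diff_poly R}) (r : nat).
Hypothesis iota_ord : forall a, iota a \in ord_lt r.
Hypothesis iota_surj : forall p, p \in ord_lt r -> exists a, iota a = p.

Lemma ord_ltS_horner p : p \in ord_lt r.+1 ->
  exists B : {poly E}, p = (map_poly iota B).['Y_r].
Proof.
move: p; apply: diff_poly_ind => [c|k|_ _ [B ->] [C ->]|_ _ [B ->] [C ->]].
- have [a <-] := iota_surj (ord_ltC r c).
  by exists a%:P; rewrite map_polyC hornerC.
- rewrite ltnS leq_eqVlt => /orP[/eqP->|kr].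
    by exists 'X; rewrite map_polyX hornerX.
  have [a <-] := iota_surj (ord_ltX R kr).
  by exists a%:P; rewrite map_polyC hornerC.
- by exists (B + C); rewrite rmorphD hornerD.
- by exists (B * C); rewrite rmorphM hornerM.
Qed.

Hypothesis iota_inj : injective (ev \o iota).
Variable A : {poly E}.
Hypothesis Amin : min_annihilator (ev \o iota) (iter r dS x) A.

(** G is the leading coefficient of A times the norm of A' * B, where B is the
reduction of c modulo the separant.  The identity expressing the norm as a
multiple of A' * B vanishes at x, hence at alpha, so neither the separant nor c
can vanish at alpha when G does not.  Compatibility follows because both the
separant and the leading coefficient may then be cancelled. *)
Lemma min_annihilator_regular c : ev c != 0 -> exists2 G : E, G != 0 &
  forall (F : idomainType) (dF : F -> F) (phi : {rmorphism R -> F}) (alpha : F),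
  is_derivation dF -> (forall a, phi (dR a) = dF (phi a)) ->
  let evF := diff_eval_at dF phi alpha in
  evF (iota G) != 0 -> evF (iota (lead_coef A)) != 0 /\
  (root (map_poly (evF \o iota) A) (iter r dF alpha) ->
   [/\ ~~ root (map_poly (evF \o iota) A^`()) (iter r dF alpha),
       specializes ev evF & evF c != 0]).
Proof.
move=> c0; pose mS := Model x dS_der j_diff.
have [A0 rA _] := Amin.
have onS : on_hypersurface iota r A mS by apply/eqP; exact: rA.
have sepS : model_poly iota r mS A^`() != 0.
  exact: (min_annihilator_separant iota_inj Amin S_char0).
have [k [B eB]] := separant_reduction dR iota_ord iota_surj A c.
have C0 : ~~ root (map_poly (ev \o iota) (A^`() * B)) (iter r dS x).
  change (model_poly iota r mS (A^`() * B) != 0).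
  by rewrite rmorphM -eB // !mulf_neq0 // expf_neq0.
have [G G0 [U eG]] := min_annihilator_norm iota_inj Amin C0.
exists (lead_coef A * G).
  by rewrite -(inj_eq iota_inj) rmorph0 rmorphM mulf_neq0 // -(rmorph0 (ev \o iota))
     (inj_eq iota_inj) // lead_coef_eq0.
move=> F dF phi alpha dF_der phi_diff evF.
pose mF := Model alpha dF_der phi_diff.
rewrite (rmorphM iota) (rmorphM evF) mulf_eq0 negb_or => /andP[lA GF]; split=> // rAF.
have onF : on_hypersurface iota r A mF by apply/eqP; exact: rAF.
(* Relations of order at most r pass from x to alpha. *)
have transfer D : model_poly iota r mS D = 0 -> model_poly iota r mF D = 0.
  move=> /eqP D0; apply/eqP;
  exact: (min_annihilator_specialize Amin (h := evF \o iota) lA rAF D0).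
have : model_poly iota r mF (G%:P - U * (A^`() * B)) = 0.
  apply: transfer; rewrite rmorphB (rmorphM (model_poly iota r mS) U) model_polyC.
  by apply/eqP; rewrite subr_eq0; apply/eqP; exact: eG.
rewrite rmorphB !(rmorphM (model_poly iota r mF)) model_polyC -eB // => /eqP.
rewrite subr_eq0 => /eqP eGF; have : model_eval mF (iota G) != 0 by [].
rewrite eGF !mulf_eq0 !negb_or => /and3P[_ sepF /andP[_ cF]].
split=> // p ep.
have [l [D eD]] := separant_reduction dR iota_ord iota_surj A p.
have : model_poly iota r mF D = 0 by apply: transfer; rewrite -eD // [model_eval _ _]ep mulr0.
by rewrite -eD // => /eqP; rewrite mulf_eq0 expf_eq0 (negPf sepF) andbF => /eqP.
Qed.
End OrderSplit.
End Specialization.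

(** * Zeros in a differentially closed field *)

(** Applying phi to the coefficients makes a differential polynomial over R one
over F, to which differential closedness applies. *)
HB.lock Definition dmap (R T : comNzRingType) (phi : {rmorphism R -> T}) :
  {rmorphism diff_poly R -> diff_poly T} := deval (dvar T) (dconst T \o phi).

Section CoefficientMap.
Variables (R T : comNzRingType) (phi : {rmorphism R -> T}).

Lemma dmapC c : dmap phi c%:DP = (phi c)%:DP.
Proof. by rewrite dmap.unlock; exact: deval_const. Qed.

Lemma dmapY k : dmap phi 'Y_k = 'Y_k.
Proof. by rewrite dmap.unlock; exact: deval_var. Qed.

Lemma mcoeff_dmap p m : (dmap phi p)@_m = phi (p@_m).
Proof.
have -> : dmap phi p = \sum_(n <- msupp p) << phi p@_n *g n >>.
  rewrite dmap.unlock [LHS]mmapE; apply: eq_bigr => n _; exact: dconst_monom.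
rewrite (raddf_sum (mcoeff m)) [in RHS](monalgE p).
rewrite (raddf_sum (mcoeff m)) rmorph_sum /=.
by apply: eq_bigr => n _; rewrite !mcoeffU rmorphMn.
Qed.

Lemma dmap_ord_lt r p : p \in ord_lt r -> dmap phi p \in ord_lt r.
Proof.
move/ord_ltP => hp; apply/ord_ltP => m; rewrite -mcoeff_neq0 mcoeff_dmap => pm.
by apply: hp; rewrite -mcoeff_neq0; apply: contraNneq pm => ->; rewrite rmorph0.
Qed.

Lemma diff_eval_at_dmap (dT : T -> T) alpha p :
  diff_eval_at dT idfun alpha (dmap phi p) = diff_eval_at dT phi alpha p.
Proof.
have [n] := ord_lt_bound p; move: p; apply: diff_poly_ind.
- by move=> c; rewrite dmapC (diff_eval_at_const _ idfun) (diff_eval_at_const _ phi).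
- by move=> k _; rewrite dmapY (diff_eval_at_var _ idfun) (diff_eval_at_var _ phi).
- by move=> p q IHp IHq; rewrite !rmorphD IHp IHq.
- by move=> p q IHp IHq; rewrite !rmorphM IHp IHq.
Qed.
End CoefficientMap.

(** Differential polynomials viewed as polynomials in y^(r) over the same ring.
Substituting y^(r) back is a left inverse, which yields the algebraic
independence of y^(r) from the variables of lower order. *)
HB.lock Definition single_out (R : comNzRingType) (r : nat) :
    {rmorphism diff_poly R -> {poly diff_poly R}} :=
  deval (fun k => if k == r then 'X else ('Y_k)%:P) (polyC \o dconst R).

Arguments single_out {R} r.

Section SeparateVariable.
Variables (R : comNzRingType) (r : nat).

Lemma single_outC (c : R) : single_out r c%:DP = (c%:DP)%:P.
Proof. by rewrite single_out.unlock; exact: deval_const. Qed.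

Lemma single_outY k : single_out r ('Y_k : diff_poly R) = if k == r then 'X else ('Y_k)%:P.
Proof. by rewrite single_out.unlock; exact: deval_var. Qed.

Lemma single_out_ord_lt (p : diff_poly R) : p \in ord_lt r -> single_out r p = p%:P.
Proof.
move: p; apply: diff_poly_ind => [c|k kr|p q IHp IHq|p q IHp IHq].
- by rewrite single_outC.
- by rewrite single_outY ltn_eqF.
- by rewrite rmorphD IHp IHq polyCD.
- by rewrite rmorphM IHp IHq polyCM.
Qed.

Lemma single_outK (p : diff_poly R) : (single_out r p).['Y_r] = p.
Proof.
have [n] := ord_lt_bound p; move: p; apply: diff_poly_ind => [c|k _|p q IHp IHq|p q IHp IHq].
- by rewrite single_outC hornerC.
- by rewrite single_outY; case: eqP => [->|_]; rewrite ?hornerX ?hornerC.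
- by rewrite rmorphD hornerD IHp IHq.
- by rewrite rmorphM hornerM IHp IHq.
Qed.

Lemma single_out_horner (B : {poly diff_poly R}) : B \is a polyOver (ord_lt r) ->
  single_out r B.['Y_r] = B.
Proof.
move/polyOverP => hB; rewrite -horner_map single_outY eqxx.
have -> : map_poly (single_out r) B = map_poly polyC B.
  by apply/polyP => i; rewrite coef_map [RHS]coef_map; exact/single_out_ord_lt/hB.
exact: comp_polyXr.
Qed.

(** If B.[y^(r)] had order less than r, [single_out] would map it both to B and to
a constant. *)
Lemma horner_not_ord_lt (B : {poly diff_poly R}) : B \is a polyOver (ord_lt r) ->
  (1 < size B)%N -> B.['Y_r] \notin ord_lt r.
Proof.
move=> hB sB; apply/negP => /single_out_ord_lt; rewrite single_out_horner // => eB.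
by move: sB; rewrite eB ltnNge size_polyC_leq1.
Qed.

Lemma var_not_ord_lt : dvar R r \notin ord_lt r.
Proof.
rewrite -[X in X \notin _]hornerX; apply: horner_not_ord_lt.
  by rewrite polyOverX.
by rewrite size_polyX.
Qed.

(** The second factor becomes monic in y^(r), hence regular. *)
Lemma mul_var_sub_const_neq0 (p : diff_poly R) c : p != 0 -> p * ('Y_r - c%:DP) != 0.
Proof.
apply: contra_neq => /(congr1 (single_out r)); rewrite rmorphM rmorphB rmorph0.
rewrite single_outY eqxx single_outC => e.
have /rreg_lead : GRing.rreg (lead_coef ('X - (c%:DP : diff_poly R)%:P)).
  by rewrite lead_coefXsubC; exact: rreg1.
move=> reg; rewrite -[p]single_outK (reg (single_out r p) 0) ?horner0 //.
by rewrite e mul0r.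
Qed.
End SeparateVariable.

Section Closed.
Variables (F : fieldType) (dF : F -> F).
Hypotheses (F_diff : is_derivation dF) (F_closed : differentially_closed dF).

Let evF (alpha : F) : {rmorphism diff_poly F -> F} := diff_eval_at dF idfun alpha.

Lemma diff_ord1_leq (p : diff_poly F) r : (diff_ord1 p <= r)%N = (p \in ord_lt r).
Proof.
apply/bigmax_leqP_seq/ord_ltP => [H m mp k km|H m mp _].
  by have /bigmax_leqP_seq/(_ k km isT) := H m mp isT.
by apply/bigmax_leqP_seq => k km _; apply: H km.
Qed.

Lemma diff_zero r (A B : diff_poly F) : B \in ord_lt r -> B != 0 -> A \notin ord_lt r ->
  exists alpha, evF alpha A = 0 /\ evF alpha B != 0.
Proof.
rewrite -!diff_ord1_leq -ltnNge => Br B0 rA.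
have [alpha [hA hB]] := F_closed B0 (leq_ltn_trans Br rA).
by exists alpha; rewrite /evF diff_eval_at.unlock.
Qed.

(** Since r > 0, the factors y - c with c in s have order less than r and may be
multiplied into B. *)
Lemma diff_zero_notin r (A B : diff_poly F) (s : seq F) : (0 < r)%N ->
    B \in ord_lt r -> B != 0 -> A \notin ord_lt r ->
  exists alpha, [/\ alpha \notin s, evF alpha A = 0 & evF alpha B != 0].
Proof.
move=> r0 Br B0 rA.
pose B' := foldr (fun c p => p * ('Y_0 - c%:DP)) B.
have B'r t : B' t \in ord_lt r.
  elim: t => //= c t IH.
  by rewrite rpredM // rpredB ?ord_ltX ?ord_ltC.
have B'0 t : B' t != 0.
  by elim: t => //= c t IH; exact: mul_var_sub_const_neq0.
have [alpha [hA hB]] := diff_zero (B'r s) (B'0 s) rA; exists alpha; rewrite hA.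
move: hB; elim: s => //= c s IH.
rewrite rmorphM rmorphB [evF _ 'Y_0]diff_eval_at_var [evF _ c%:DP]diff_eval_at_const.
rewrite mulf_eq0 negb_or subr_eq0 => /andP[/IH[ns _ ->] ac].
by rewrite inE negb_or ac ns.
Qed.

(** Apply closedness to p read as an equation of order 0, and B = 1. *)
Lemma closed_root (p : {poly F}) : (1 < size p)%N -> exists alpha, root p alpha.
Proof.
move=> p1; pose P := map_poly (dconst F) p.
have [|||alpha [hA _]] := @diff_zero 0 P.['Y_0] 1.
- exact: rpred1.
- exact: oner_neq0.
- apply: horner_not_ord_lt.
    by apply/polyOverP => i; rewrite coef_map; exact: ord_ltC.
  by rewrite size_map_inj_poly ?rmorph0 //; exact: dconst_inj.
exists alpha; apply/rootP; move: hA; rewrite -horner_map -map_poly_comp.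
rewrite [X in _.[X]]diff_eval_at_var map_poly_id // => a _.
exact: diff_eval_at_const.
Qed.
End Closed.

Lemma exists_min_annihilator (E S : nzRingType) (e : E -> S) xi (B : {poly E}) :
  B != 0 -> root (map_poly e B) xi -> exists A, min_annihilator e xi A.
Proof.
move=> B0 rB; pose Pn n := `[< exists B : {poly E},
  [/\ B != 0, root (map_poly e B) xi & size B = n] >].
have exP : exists n, Pn n by exists (size B); apply/asboolP; exists B.
case: (ex_minnP exP) => n /asboolP[A [A0 rA <-]] Amin; exists A; split=> // C C0 rC.
by apply: Amin; apply/asboolP; exists C.
Qed.

Section OneGenerator.
Variables (F : fieldType) (dF : F -> F).
Hypotheses (F_diff : is_derivation dF) (F_closed : differentially_closed dF).
Variables (R : comNzRingType) (dR : R -> R) (S : idomainType) (dS : S -> S).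
Variables (j : {rmorphism R -> S}) (x : S).
Hypotheses (dS_der : is_derivation dS) (j_diff : forall a, j (dR a) = dS (j a)).
Hypotheses (j_inj : injective j) (S_char0 : [pchar S] =i pred0).

Let ev : {rmorphism diff_poly R -> S} := diff_eval_at dS j x.
Let evF (phi : {rmorphism R -> F}) (alpha : F) : {rmorphism diff_poly R -> F} :=
  diff_eval_at dF phi alpha.

Let ev_dconst_inj : injective (ev \o dconst R).
Proof.
by move=> a b /=; rewrite [ev _]diff_eval_at_const [RHS]diff_eval_at_const; exact: j_inj.
Qed.

Let dconst_surj p : p \in ord_lt 0 -> exists a, dconst R a = p.
Proof.
move: p; apply: diff_poly_ind => // [c|_ _ [a <-] [b <-]|_ _ [a <-] [b <-]].
- by exists c.
- by exists (a + b); rewrite rmorphD.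
- by exists (a * b); rewrite rmorphM.
Qed.

Let map_ev_dconst (B : {poly R}) : map_poly (ev \o dconst R) B = map_poly j B.
Proof. by apply: eq_map_poly => a; rewrite /= [LHS]diff_eval_at_const. Qed.

(** * Specializing one generator *)

(** The case r = 0 of [min_annihilator_regular], where E is R itself. *)
Lemma algebraic_specializations (A : {poly R}) c : min_annihilator j x A ->
  ev c != 0 -> exists2 a : R, a != 0 & forall phi : {rmorphism R -> F},
  (forall a, phi (dR a) = dF (phi a)) -> phi a != 0 ->
  phi (lead_coef A) != 0 /\ forall alpha, root (map_poly phi A) alpha ->
  [/\ ~~ root (map_poly phi A^`()) alpha, specializes ev (evF phi alpha) &
      evF phi alpha c != 0].
Proof.
move=> [A0 rA Amin] c0.
have Amin' : min_annihilator (ev \o dconst R) (iter 0 dS x) A.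
  by split=> [||B B0]; rewrite // map_ev_dconst //; exact: Amin.
have [a a0 Ha] := min_annihilator_regular dS_der j_diff S_char0
  (fun a => ord_ltC 0 a) dconst_surj ev_dconst_inj Amin' c0.
exists a => // phi phi_diff phia.
have map_evF alpha (B : {poly R}) :
    map_poly (evF phi alpha \o dconst R) B = map_poly phi B.
  by apply: eq_map_poly => b; rewrite /= [LHS]diff_eval_at_const.
have evFC alpha b : evF phi alpha (dconst R b) = phi b by exact: diff_eval_at_const.
split.
  have [] := Ha F dF phi 0 F_diff phi_diff; first by rewrite [_ (dconst R a)]evFC.
  by rewrite [_ (dconst R _)]evFC.
move=> alpha; have [] := Ha F dF phi alpha F_diff phi_diff.
  by rewrite [_ (dconst R a)]evFC.
by move=> _ H ra; move: H; rewrite !map_evF; exact.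
Qed.

(** Let r be the least order of an equation of x over R, if there is one.  It is
positive since x is transcendental, so a zero of A can be chosen away from s.  If
there is no equation, y^(n) = 0 with n large serves as an equation.
The witness a is a coefficient of c or of G: phi a <> 0 keeps that polynomial
non-zero after phi is applied to it. *)
Lemma transcendental_specializations c :
    (forall B : {poly R}, root (map_poly j B) x -> B = 0) ->
  ev c != 0 -> exists2 a : R, a != 0 & forall phi : {rmorphism R -> F},
  (forall a, phi (dR a) = dF (phi a)) -> phi a != 0 ->
  forall s : seq F, exists alpha, [/\ alpha \notin s,
    specializes ev (evF phi alpha) & evF phi alpha c != 0].
Proof.
move=> x_tr c0.
have coef_neq0 (p : diff_poly R) : p != 0 -> exists m, p@_m != 0.
  move=> p0; apply: contrapT => H; case/negP: p0; apply/eqP/malgP => m.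
  by rewrite mcoeff0; apply/eqP/negPn/negP => pm; apply: H; exists m.
have dmap_neq0 (phi : {rmorphism R -> F}) p m : phi (p@_m) != 0 -> dmap phi p != 0.
  by rewrite -mcoeff_dmap; apply: contraNneq => ->; rewrite mcoeff0.
have [ev_inj|] := pselect (forall p, ev p = 0 -> p = 0).
  have [|m cm] := coef_neq0 c; first by apply: contraNneq c0 => ->; rewrite rmorph0.
  exists c@_m => // phi phi_diff phic s.
  have [n cn] := ord_lt_bound (dmap phi c).
  have [||||alpha [alphas _ alphac]] :=
      @diff_zero_notin F dF F_closed n.+1 'Y_n.+1 (dmap phi c) s.
  - by [].
  - exact: ord_ltS cn.
  - exact: dmap_neq0 phic.
  - exact: var_not_ord_lt.
  exists alpha; split=> //; last by rewrite -diff_eval_at_dmap.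
  by move=> p /ev_inj ->; rewrite rmorph0.
move=> /existsNP[p0 /not_implyP[evp0 /eqP p0_neq0]].
pose Pn n := `[< exists p, [/\ p \in ord_lt n, p != 0 & ev p = 0] >].
have exP : exists n, Pn n.
  by have [n p0n] := ord_lt_bound p0; exists n; apply/asboolP; exists p0.
case: (ex_minnP exP) => [[|r]] /asboolP[p [pr p_neq0 evp]] rmin.
  have [a ea] := dconst_surj pr; move: evp p_neq0; rewrite -ea.
  move=> /eqP; rewrite [ev _]diff_eval_at_const -(rmorph0 j) (inj_eq j_inj) => /eqP ->.
  by rewrite rmorph0 eqxx.
have r0 : (0 < r)%N.
  rewrite lt0n; apply: contraNneq p_neq0 => r0; rewrite r0 in pr.
  have [B eB] := ord_ltS_horner dconst_surj pr; rewrite eB.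
  rewrite (x_tr B) ?rmorph0 ?horner0 //; apply/rootP.
  move: evp; rewrite eB -horner_map -map_poly_comp [map_poly _ B]map_ev_dconst.
  by rewrite [X in _.[X]]diff_eval_at_var.
pose E := subring_of (ord_lt_subring R r).
pose iota : {rmorphism E -> diff_poly R} := val.
have iota_ord (b : E) : iota b \in ord_lt r by exact: valP b.
have iota_surj q : q \in ord_lt r -> exists b, iota b = q.
  by move=> qr; exists (Sub q qr : E); exact: SubK.
have iota_inj : injective (ev \o iota).
  move=> b b' /eqP /=; rewrite -subr_eq0 -rmorphB => /eqP evb.
  apply: val_inj; apply/eqP; rewrite -subr_eq0 -[_ - _]/(iota b - iota b').
  rewrite -rmorphB in evb *; apply: contraT => b0.
  suff /rmin : Pn r by rewrite ltnn.
  by apply/asboolP; exists (iota (b - b')).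
have [B eB] := ord_ltS_horner iota_surj pr.
have [||A Amin] := @exists_min_annihilator E S (ev \o iota) (iter r dS x) B.
- by apply: contraNneq p_neq0 => B0; rewrite eB B0 rmorph0 horner0.
- apply/rootP; rewrite -[RHS]evp eB -horner_map -map_poly_comp.
  by rewrite [X in _ = _.[X]]diff_eval_at_var.
have [G G0 HG] := min_annihilator_regular dS_der j_diff S_char0
  iota_ord iota_surj iota_inj Amin c0.
have [|m Gm] := coef_neq0 (iota G).
  apply: contraNneq G0 => G0; apply/eqP/iota_inj.
  by rewrite [RHS]rmorph0 [LHS](congr1 ev G0) rmorph0.
exists (iota G)@_m => // phi phi_diff phiG s.
have A1 := min_annihilator_size_gt1 iota_inj Amin.
have iG_ord : dmap phi (iota G) \in ord_lt r by exact: dmap_ord_lt.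
have iG_neq0 := dmap_neq0 _ _ _ phiG.
pose AF := map_poly (dmap phi \o iota) A.
have AF_over : AF \is a polyOver (ord_lt r).
  by apply/polyOverP => i; rewrite coef_map; apply: dmap_ord_lt; exact: iota_ord.
have AF1 : (1 < size AF)%N.
  (* The leading coefficient of A survives phi, as it does at a point where G is non-zero. *)
  have [beta [_]] := diff_zero F_closed iG_ord iG_neq0 (var_not_ord_lt F r).
  rewrite diff_eval_at_dmap => /(HG _ _ _ _ F_diff phi_diff)[lA _].
  rewrite size_map_poly_id0 //; apply: contraNneq lA => lA.
  by rewrite -diff_eval_at_dmap [dmap _ _]lA rmorph0.
have [alpha [alphas hA hG]] :=
  diff_zero_notin F_closed s r0 iG_ord iG_neq0 (horner_not_ord_lt AF_over AF1).
rewrite diff_eval_at_dmap in hG.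
exists alpha; have [_ H] := HG _ _ _ _ F_diff phi_diff hG.
have [|_ sp c_alpha] := H; last by split.
apply/rootP; rewrite -[RHS]hA -horner_map -map_poly_comp.
rewrite [X in _ = _.[X]]diff_eval_at_var; congr _.[_]; apply: eq_map_poly => b.
exact: esym (diff_eval_at_dmap _ _ _ _).
Qed.
End OneGenerator.

(** * The generic extension theorem *)

Definition diff_hom (A B : Type) (dA : A -> A) (dB : B -> B) (f : A -> B) :=
  forall a, f (dA a) = dB (f a).

Definition diff_generated (R S : nzRingType) (j : R -> S) (dS : S -> S) (xs : seq S) :=
  forall P : {pred S}, GRing.subring_closed P -> (forall a, j a \in P) ->
  (forall x, x \in xs -> forall k, iter k dS x \in P) -> forall s, s \in P.

(** Consequently R{x} is stable under the derivation, and a homomorphism induced on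
it by evaluation at some alpha commutes with the derivations. *)
Lemma model_eval_der (R : comNzRingType) (dR : R -> R) (p : diff_poly R) :
  exists q, forall m : model dR, mD (model_eval m p) = model_eval m q.
Proof.
have [n] := ord_lt_bound p; move: p.
apply: diff_poly_ind => [c|k _|p q [p' hp] [q' hq]|p q [p' hp] [q' hq]].
- exists (dR c)%:DP => m.
  by rewrite [model_eval m c%:DP]diff_eval_at_const [RHS]diff_eval_at_const mh_diff.
- by exists 'Y_k.+1 => m; rewrite model_evalYS.
- by exists (p' + q') => m; rewrite !(rmorphD (model_eval m)) -hp -hq (derD (mD_der m)).
- exists (p' * q + p * q') => m.
  by rewrite (rmorphM (model_eval m) p q) (derM (mD_der m)) hp hq -!rmorphM -rmorphD.
Qed.

Section Adjunction.
Variables (R : comNzRingType) (dR : R -> R) (S : comNzRingType) (dS : S -> S).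
Variables (j : {rmorphism R -> S}) (x : S).
Hypotheses (dS_der : is_derivation dS) (j_diff : diff_hom dR dS j).

Let ev : {rmorphism diff_poly R -> S} := diff_eval_at dS j x.

Definition adjoined_pred : {pred S} := fun s => `[< exists p, s = ev p >].

Lemma adjoinedP s : reflect (exists p, s = ev p) (s \in adjoined_pred).
Proof. exact: asboolP. Qed.

Lemma adjoined_subring : GRing.subring_closed adjoined_pred.
Proof.
split.
- by apply/adjoinedP; exists 1; rewrite rmorph1.
- move=> _ _ /adjoinedP[p ->] /adjoinedP[q ->]; apply/adjoinedP.
  by exists (p - q); rewrite rmorphB.
- move=> _ _ /adjoinedP[p ->] /adjoinedP[q ->]; apply/adjoinedP.
  by exists (p * q); rewrite rmorphM.
Qed.

Definition adjoined := subring_of adjoined_subring.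
Definition adjoined_incl : {rmorphism adjoined -> S} := val.

Lemma adjoined_inclE (y : adjoined) : exists p, adjoined_incl y = ev p.
Proof. exact/adjoinedP/(valP y). Qed.

Lemma adjoined_incl_surj p : exists y, adjoined_incl y = ev p.
Proof.
have pP : ev p \in adjoined_pred by apply/adjoinedP; exists p.
by exists (Sub (ev p) pP : adjoined); exact: SubK.
Qed.

Lemma adjoined_der_subproof (y : adjoined) : dS (val y) \in adjoined_pred.
Proof.
have [p ep] := adjoined_inclE y; have [q eq] := model_eval_der dR p.
apply/adjoinedP; exists q; rewrite -[RHS](eq (Model x dS_der j_diff)).
by congr (dS _); exact: ep.
Qed.

Definition adjoined_der (y : adjoined) : adjoined :=
  Sub (dS (val y)) (adjoined_der_subproof y).

Lemma adjoined_incl_diff : diff_hom adjoined_der dS adjoined_incl.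
Proof. by move=> y; exact: SubK. Qed.

Lemma adjoined_incl_inj : injective adjoined_incl.
Proof. exact: val_inj. Qed.

End Adjunction.

Section Extension.
Variables (F : fieldType) (dF : F -> F).
Hypotheses (F_diff : is_derivation dF) (F_closed : differentially_closed dF).

Definition generic_extension (R S : nzRingType) (dR : R -> R) (dS : S -> S) (j : R -> S)
    (b : S) :=
  exists2 a : R, a != 0 & forall phi : {rmorphism R -> F},
    diff_hom dR dF phi -> phi a != 0 ->
  exists psi : {rmorphism S -> F},
    [/\ diff_hom dS dF psi, forall r, psi (j r) = phi r & psi b != 0].

Section OneStep.
Variables (R : comNzRingType) (dR : R -> R) (S : idomainType) (dS : S -> S).
Variables (j : {rmorphism R -> S}) (x : S).
Hypotheses (dS_der : is_derivation dS) (j_diff : diff_hom dR dS j).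

Let ev : {rmorphism diff_poly R -> S} := diff_eval_at dS j x.
Let R' := adjoined dS j x.
Let dR' : R' -> R' := adjoined_der dS_der j_diff.
Let j' : {rmorphism R' -> S} := adjoined_incl dS j x.

(** Evaluation at alpha factors through R{x}, and the hypothesis extends the
resulting homomorphism from R{x} to S.  The polynomial c represents the element
of R{x} whose non-vanishing that requires. *)
Lemma extension_of_point b : generic_extension dR' dS j' b ->
  exists2 c, ev c != 0 & forall (phi : {rmorphism R -> F}) alpha,
    diff_hom dR dF phi -> specializes ev (diff_eval_at dF phi alpha) ->
    diff_eval_at dF phi alpha c != 0 ->
  exists psi : {rmorphism S -> F}, [/\ diff_hom dS dF psi,
    forall r, psi (j r) = phi r, psi x = alpha & psi b != 0].
Proof.
move=> [a a0 Ha]; have [c ec] := adjoined_inclE a; exists c.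
  by rewrite -[X in X != 0]ec -(rmorph0 j') (inj_eq (@adjoined_incl_inj _ _ _ _ _)).
move=> phi alpha phi_diff sp c0.
have [h hE] := factor_rmorphism (@adjoined_incl_inj _ _ _ _ _)
  (@adjoined_inclE _ _ dS j x) sp.
have h_diff : diff_hom dR' dF h.
  move=> y; have [p ep] := adjoined_inclE y; have [q eq] := model_eval_der dR p.
  rewrite (hE _ _ ep) (hE _ q); first exact/esym/(eq (Model alpha F_diff phi_diff)).
  by rewrite adjoined_incl_diff ep; exact: (eq (Model x dS_der j_diff)).
have [|psi [psi_diff psiE psib]] := Ha h h_diff; first by rewrite (hE _ _ ec).
exists psi; split=> // [r|].
  have [y ey] := adjoined_incl_surj dS j x r%:DP.
  by rewrite -(diff_eval_at_const dF phi alpha) -(hE _ _ ey) -psiE [j' y]ey diff_eval_at_const.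
have [y ey] := adjoined_incl_surj dS j x 'Y_0.
rewrite -[RHS](diff_eval_at_var dF phi alpha 0) -(hE _ _ ey) -psiE [j' y]ey.
by rewrite diff_eval_at_var.
Qed.
End OneStep.

(** Induction on the generators, one at a time from the bottom: the induction
hypothesis is applied to R{x} in S. *)
Theorem differential_extension (S : idomainType) (dS : S -> S) (xs : seq S)
    (R : comNzRingType) (dR : R -> R) (j : {rmorphism R -> S}) :
  is_derivation dS -> diff_hom dR dS j -> injective j -> [pchar S] =i pred0 ->
  diff_generated j dS xs -> forall b, b != 0 -> generic_extension dR dS j b.
Proof.
move=> dS_der; elim: xs R dR j => [|x xs IH] R dR j j_diff j_inj S0 gen b b0.
  have j_surj s : exists a, s = j a.
    apply/asboolP; apply: (gen (fun s => `[< exists a, s = j a >])).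
    - split; first by apply/asboolP; exists 1; rewrite rmorph1.
        move=> _ _ /asboolP[p ->] /asboolP[q ->]; apply/asboolP.
        by exists (p - q); rewrite rmorphB.
      move=> _ _ /asboolP[p ->] /asboolP[q ->]; apply/asboolP.
      by exists (p * q); rewrite rmorphM.
    - by move=> a; apply/asboolP; exists a.
    - by [].
  have [a ea] := j_surj b; exists a.
    by apply: contraNneq b0 => a0; rewrite ea a0 rmorph0.
  move=> phi phi_diff phia.
  have [||psi psiE] := @factor_rmorphism R S S F j idfun phi _ j_surj.
  - by [].
  - by move=> r /eqP; rewrite -(rmorph0 j) (inj_eq j_inj) => /eqP ->; rewrite rmorph0.
  exists psi; split=> [s|r|].
  - have [r er] := j_surj s; rewrite (psiE _ _ er) -phi_diff.
    by apply: psiE; rewrite er /= j_diff.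
  - exact: psiE.
  - by rewrite (psiE _ _ ea).
have [|c c0 Hc] := @extension_of_point R dR S dS j x dS_der j_diff b.
  apply: (IH _ (adjoined_der dS_der j_diff) (adjoined_incl dS j x)) => //.
  move=> P subP jP xsP; apply: gen => // [a|y].
      have [z ez] := adjoined_incl_surj dS j x a%:DP.
      by rewrite -(diff_eval_at_const dS j x) -ez; exact: jP.
    rewrite inE => /orP[/eqP -> k|/xsP//].
    have [z ez] := adjoined_incl_surj dS j x 'Y_k.
    by rewrite -(diff_eval_at_var dS j x) -ez; exact: jP.
have [x_tr|] := pselect (forall B : {poly R}, root (map_poly j B) x -> B = 0).
  have [a a0 Ha] :=
    transcendental_specializations F_diff F_closed dS_der j_diff j_inj S0 x_tr c0.
  exists a => // phi phi_diff phia.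
  have [alpha [_ sp ca]] := Ha phi phi_diff phia [::].
  by have [psi []] := Hc phi alpha phi_diff sp ca; exists psi.
move=> /existsNP[B /not_implyP[rB /eqP B0]].
have [A Amin] := exists_min_annihilator B0 rB.
have [a a0 Ha] := algebraic_specializations F_diff dS_der j_diff j_inj S0 Amin c0.
exists a => // phi phi_diff phia; have [lA H] := Ha phi phi_diff phia.
have [|alpha ra] := @closed_root F dF F_closed (map_poly phi A).
  by rewrite size_map_poly_id0 //; exact: (min_annihilator_size_gt1 j_inj Amin).
have [_ sp ca] := H alpha ra.
by have [psi []] := Hc phi alpha phi_diff sp ca; exists psi.
Qed.
End Extension.

(** * Fields of fractions and the degree *)

Section FractionPolynomials.
Variable R : idomainType.
Local Notation tf := (@FracField.tofrac R).

Lemma fraction_split (u : {fraction R}) : exists n d : R, d != 0 /\ u = tf n / tf d.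
Proof.
exists (\n_(repr u)), (\d_(repr u)); have d0 := denom_ratioP (repr u); split=> //.
rewrite -{1}[u]reprK; apply: (canRL (mulfK _)); first by rewrite tofrac_eq0.
unlock FracField.tofrac; rewrite -[LHS]FracField.pi_mul.
apply/eqmodP; rewrite /= FracField.equivfE /FracField.mulf.
by rewrite !numden_Ratio ?mulf_neq0 ?oner_neq0 // !mulr1 mulrC.
Qed.

Lemma clear_denominators (p : {poly {fraction R}}) :
  exists2 d : R, d != 0 & exists q, tf d *: p = map_poly tf q.
Proof.
elim/poly_ind: p => [|p c [d d0 [q eq]]].
  by exists 1; rewrite ?oner_neq0 //; exists 0; rewrite scaler0 rmorph0.
have [n [m [m0 ->]]] := fraction_split c.
exists (m * d); first by rewrite mulf_neq0.
exists (m *: q * 'X + (d * n)%:P).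
rewrite tofracM (rmorphD (map_poly tf)) (rmorphM (map_poly tf)) /=.
rewrite map_polyX map_polyZ /= map_polyC /= -eq.
rewrite scalerDr; congr (_ + _).
  by rewrite -!scalerAl scalerA.
rewrite -mul_polyC -polyCM; congr _%:P.
by rewrite tofracM mulrA mulrAC [tf m * _]mulrC mulfK ?tofrac_eq0 // mulrC.
Qed.
End FractionPolynomials.

Section FractionalHull.
Variables (S : idomainType) (P : pred S) (R : subIdomainType P).
Let j : {rmorphism R -> S} := val.
Local Notation tfR := (@FracField.tofrac R).
Local Notation tfS := (@FracField.tofrac S).

Let j_inj : injective j. Proof. exact: val_inj. Qed.

Let j_eq0 r : (j r == 0) = (r == 0).
Proof. by rewrite -(rmorph0 j) (inj_eq j_inj). Qed.

Lemma fract_incl_tofrac (r : R) : fract_incl R (tfR r) = tfS (val r).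
Proof.
rewrite -[tfR r]divr1 -tofrac1 fract_incl_frac ?oner_neq0 //.
by rewrite rmorph1 tofrac1 divr1.
Qed.

Section Hull.
Variable z : S.

(** The elements of S lying in the field Fract R (z), provided z is algebraic over
R, without mention of fractions. *)
Definition hull : {pred S} := fun s =>
  `[< exists2 r : R, r != 0 & exists p, j r * s = (map_poly j p).[z] >].

Lemma hullP s : reflect
  (exists2 r : R, r != 0 & exists p, j r * s = (map_poly j p).[z]) (s \in hull).
Proof. exact: asboolP. Qed.

Lemma hull_horner p : (map_poly j p).[z] \in hull.
Proof.
by apply/hullP; exists 1; rewrite ?oner_neq0 //; exists p; rewrite rmorph1 mul1r.
Qed.

Lemma hull_subring : GRing.subring_closed hull.
Proof.
split=> [|s t /hullP[r r0 [p ep]] /hullP[r' r'0 [q eq]]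
         |s t /hullP[r r0 [p ep]] /hullP[r' r'0 [q eq]]].
- by have := hull_horner 1; rewrite rmorph1 hornerC.
- apply/hullP; exists (r * r'); first by rewrite mulf_neq0.
  exists (r' *: p - r *: q).
  rewrite rmorphB /= !map_polyZ hornerD hornerN !hornerZ -ep -eq rmorphM.
  by rewrite mulrBr [j r' * (_ * _)]mulrCA !mulrA.
- apply/hullP; exists (r * r'); first by rewrite mulf_neq0.
  by exists (p * q); rewrite (rmorphM (map_poly j)) hornerM -ep -eq rmorphM mulrACA.
Qed.
HB.instance Definition _ := GRing.isSubringClosed.Build S hull hull_subring.

Lemma hull_incl r : j r \in hull.
Proof. by have := hull_horner r%:P; rewrite map_polyC hornerC. Qed.

Lemma hull_div r s : r != 0 -> j r * s \in hull -> s \in hull.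
Proof.
move=> r0 /hullP[r' r'0 [p ep]]; apply/hullP.
exists (r' * r); first by rewrite mulf_neq0.
by exists p; rewrite rmorphM -mulrA.
Qed.

Lemma hull_of_fraction (p : {poly {fraction R}}) s :
  (map_poly (fract_incl R) p).[tfS z] = tfS s -> s \in hull.
Proof.
move=> es; have [d d0 [q eq]] := clear_denominators p.
apply/hullP; exists d => //; exists q; apply/eqP; rewrite -tofrac_eq tofracM -es.
rewrite -[tfS (j d)]fract_incl_tofrac -hornerZ -map_polyZ eq -map_poly_comp -horner_map.
rewrite -map_poly_comp; apply/eqP; congr _.[_]; apply: eq_map_poly => a.
exact: fract_incl_tofrac.
Qed.
End Hull.

Lemma hull_trans z w s : z \in hull w -> s \in hull z -> s \in hull w.
Proof.
move=> zw /hullP[r r0 [p ep]]; apply: (hull_div r0); rewrite ep.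
by apply: rpred_horner => //; apply/polyOverP => i; rewrite coef_map hull_incl.
Qed.

Lemma root_tofrac (B : {poly R}) z : B != 0 -> root (map_poly j B) z ->
  map_poly tfR B != 0 /\ root (map_poly (fract_incl R) (map_poly tfR B)) (tfS z).
Proof.
move=> B0 rB; split.
  apply: contraNneq B0 => /polyP B0; apply/eqP/polyP => i.
  by apply/eqP; rewrite coef0 -tofrac_eq0; have := B0 i; rewrite coef_map coef0 => ->.
apply/rootP; rewrite -map_poly_comp -[RHS](rmorph0 tfS) -(rootP rB) -horner_map.
rewrite -map_poly_comp; congr _.[_]; apply: eq_map_poly => a; exact: fract_incl_tofrac.
Qed.

Hypothesis R_char0 : [pchar R] =i pred0.

(** The primitive element of two elements of S can be taken to be an integral
combination of them, so it stays in S. *)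
Lemma primitive_generator (xs : seq S) :
    (forall x : S, exists2 B : {poly R}, B != 0 & root (map_poly j B) x) ->
  exists z, forall x, x \in xs -> x \in hull z.
Proof.
move=> alg; elim: xs => [|x xs [y IH]]; first by exists 0.
have [B B0 rB] := alg x; have [C C0 rC] := alg y.
have [B'0 rB'] := root_tofrac B0 rB; have [C'0 rC'] := root_tofrac C0 rC.
have K0 : [pchar {fraction R}] =i pred0.
  apply/pcharf0P => n; move/pcharf0P: R_char0 => <-.
  by rewrite -[RHS]tofrac_eq0 rmorph_nat.
have [n [[p ep] [q eq]]] := pchar0_PET B'0 rB' C'0 rC' K0.
exists (y *+ n - x) => t; rewrite inE => /orP[/eqP ->|/IH ty].
  by apply: (@hull_of_fraction _ p); rewrite rmorphB rmorphMn.
by apply: hull_trans ty; apply: (@hull_of_fraction _ q); rewrite rmorphB rmorphMn.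
Qed.

Section HullDerivation.
Variables (dR : R -> R) (dS : S -> S) (z : S) (A : {poly R}).
Hypotheses (dS_der : is_derivation dS) (j_diff : forall a, j (dR a) = dS (j a)).
Hypothesis Amin : min_annihilator j z A.
Hypothesis S_char0 : [pchar S] =i pred0.

Let der_horner (p : {poly R}) : exists q : {poly R},
  dS (map_poly j p).[z] = (map_poly j q).[z] + (map_poly j p^`()).[z] * dS z.
Proof.
elim/poly_ind: p => [|p c [q eq]].
  by exists 0; rewrite deriv0 !rmorph0 !horner0 mul0r addr0 (der0 dS_der).
exists (q * 'X + (dR c)%:P).
rewrite derivD derivC derivM derivX mulr1 addr0 !(rmorphD, rmorphM) /= map_polyX !map_polyC.
rewrite !(hornerD, hornerM) hornerX !hornerC (derD dS_der) (derM dS_der) eq /= j_diff.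
by rewrite !mulrDl -!addrA; congr (_ + _); rewrite mulrAC addrA addrC.
Qed.

(** Inverses up to a scalar: multiply by the cofactor of the norm. *)
Lemma hull_inverse s : s \in hull z -> s != 0 ->
  exists2 G : R, G != 0 & exists2 t, t \in hull z & t * s = j G.
Proof.
move=> /hullP[r r0 [p ep]] s0.
have [|G G0 [U eG]] := min_annihilator_norm j_inj Amin (C := p).
  by rewrite rootE -ep mulf_neq0 // j_eq0.
exists G => //; exists ((map_poly j U).[z] * j r).
  by rewrite rpredM ?hull_horner ?hull_incl.
by rewrite -mulrA ep eG.
Qed.

(** In A'(z) * dz = - A^d(z), where A^d has the derivatives of the coefficients of
A as coefficients, A'(z) <> 0 because the characteristic is 0; so dz lies in the
hull, and the derivative of a polynomial in z does too. *)
Lemma hull_der s : s \in hull z -> dS s \in hull z.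
Proof.
have dz : dS z \in hull z.
  have [q eq] := der_horner A; have [_ /rootP rA _] := Amin.
  have [|G G0 [t tz et]] := @hull_inverse (map_poly j A^`()).[z] (hull_horner _ _).
    exact: (min_annihilator_separant j_inj Amin S_char0).
  apply: (hull_div G0); rewrite -et -mulrA rpredM //.
  move: eq; rewrite rA (der0 dS_der) => /esym/eqP; rewrite addrC addr_eq0 => /eqP ->.
  by rewrite rpredN hull_horner.
move=> sz; have /hullP[r r0 [p ep]] := sz; apply: (hull_div r0).
have [q eq] := der_horner p.
have -> : j r * dS s = dS (j r * s) - j (dR r) * s.
  by rewrite (derM dS_der) j_diff addrC addKr.
by rewrite ep eq !(rpredB, rpredD, rpredM) ?hull_horner ?hull_incl.
Qed.
End HullDerivation.

Section Degree.
Variables (z : S) (A : {poly R}).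
Hypothesis Amin : min_annihilator j z A.
Hypothesis hullT : forall s, s \in hull z.
Local Notation K := {fraction R}.
Local Notation L := {fraction S}.
Let f : {rmorphism K -> L} := fract_incl R.

Let fraction_horner s : exists p, tfS s = (map_poly f p).[tfS z].
Proof.
have /hullP[r r0 [p ep]] := hullT s; exists ((tfR r)^-1 *: map_poly tfR p).
rewrite map_polyZ hornerZ fmorphV /= fract_incl_tofrac -map_poly_comp.
have -> : map_poly (f \o tfR) p = map_poly (tfS \o j) p.
  by apply: eq_map_poly => a; exact: fract_incl_tofrac.
rewrite map_poly_comp horner_map -ep rmorphM mulrA mulVf ?mul1r // tofrac_eq0.
by rewrite -[val r]/(j r) j_eq0.
Qed.

Let horner_surj l : exists p, l = (map_poly f p).[tfS z].
Proof.
have [s [t [t0 ->]]] := fraction_split l.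
have [G G0 [u _ eu]] := hull_inverse Amin (hullT t) t0.
have [p ep] := fraction_horner (s * u).
exists ((tfR G)^-1 *: p); rewrite map_polyZ hornerZ -ep fmorphV /= fract_incl_tofrac.
rewrite -[val G]/(j G) -eu !tofracM invfM [RHS]mulrC -mulrA; congr (_ * _).
have u0 : tfS u != 0.
  by rewrite tofrac_eq0; apply: contraNneq G0 => u0; rewrite -j_eq0 -eu u0 mul0r.
by rewrite mulrA divff // mul1r.
Qed.

(** Clearing denominators shows that A remains minimal over Fract R. *)
Let size_root (p : {poly K}) : p != 0 -> (map_poly f p).[tfS z] = 0 ->
  (size A <= size p)%N.
Proof.
move=> p0 rp; have [d d0 [q eq]] := clear_denominators p.
have td0 : tfR d != 0 by rewrite tofrac_eq0.
have sq : size q = size p.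
  rewrite -(size_scale _ td0) eq size_map_inj_poly ?rmorph0 //.
  by move=> a b /eqP; rewrite tofrac_eq => /eqP.
have [_ _ Am] := Amin; rewrite -sq; apply: Am.
  by rewrite -size_poly_gt0 sq size_poly_gt0.
apply/rootP/eqP; rewrite -tofrac_eq0 -horner_map -map_poly_comp.
have -> : map_poly (tfS \o j) q = map_poly (f \o tfR) q.
  by apply: eq_map_poly => a; rewrite /= fract_incl_tofrac.
by rewrite map_poly_comp -eq map_polyZ hornerZ rp mulr0.
Qed.

(** The powers of z below the degree of A form a basis of Fract S: remainders of
division by A give coordinates, which are unique by minimality. *)
Lemma hull_ext_degree : has_ext_degree (fract_incl R) (size A).-1.
Proof.
set e := (size A).-1.
have A0 : A != 0 by case: Amin.
have eS : e.+1 = size A by rewrite prednK // size_poly_gt0.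
pose g (v : 'rV[K]_e) : ext_space f := (map_poly f (rVpoly v)).[tfS z].
have g_lin a u v : g (a *: u + v) = a *: g u + g v.
  by rewrite /g linearP /= rmorphD /= map_polyZ hornerD hornerZ.
have g_inj : injective g.
  move=> u v guv; apply/eqP; rewrite -subr_eq0; apply/negPn/negP => uv0.
  have : (size A <= size (rVpoly (u - v)))%N.
    apply: size_root.
      by apply: contraNneq uv0 => r0; rewrite -[u - v]rVpolyK r0 linear0.
    have -> : u - v = (-1) *: v + u by rewrite scaleN1r addrC.
    by rewrite -[LHS]/(g _) g_lin guv scaleN1r addNr.
  by rewrite leqNgt -eS ltnS size_poly.
have rA : root (map_poly j A) z by case: Amin.
have [A'0 /rootP rA'] := root_tofrac A0 rA.
have g_surj l : exists v, g v = l.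
  have [p ep] := horner_surj l.
  exists (poly_rV (p %% map_poly tfR A)); rewrite /g poly_rV_K; last first.
    have := ltn_modpN0 p A'0; rewrite size_map_inj_poly ?rmorph0 -?eS ?ltnS //.
    by move=> a b /eqP; rewrite tofrac_eq => /eqP.
  rewrite ep {2}(divp_eq p (map_poly tfR A)) rmorphD rmorphM /= hornerD hornerM.
  by rewrite [(map_poly f (map_poly tfR A)).[_]]rA' mulr0 add0r.
have [h hK] := choice g_surj.
have gK : cancel g h by move=> v; apply: g_inj; rewrite hK.
constructor; exists h; last by exists g.
by move=> a u v; apply: g_inj; rewrite g_lin !hK.
Qed.
End Degree.
End FractionalHull.

(** * Counting extensions *)

(** Split off the roots found so far: a root of the cofactor that is already in the
list would be multiple. *)
Lemma simple_roots (F : fieldType) (p : {poly F}) :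
    (forall q : {poly F}, (1 < size q)%N -> exists alpha, root q alpha) -> p != 0 ->
    (forall alpha, root p alpha -> ~~ root p^`() alpha) ->
  exists rs, [/\ uniq rs, all (root p) rs & size rs = (size p).-1].
Proof.
move=> F_closed p0 simple.
suff : forall n, (n <= (size p).-1)%N ->
    exists rs, [/\ uniq rs, all (root p) rs & size rs = n] by apply.
elim=> [|n IH np]; first by exists [::].
have [rs [rsU rsp rsn]] := IH (ltnW np).
have rsU' : uniq_roots rs by rewrite uniq_rootsE.
have [q eq] := uniq_roots_prod_XsubC rsp rsU'.
have q1 : (1 < size q)%N.
  have q0 : q != 0 by apply: contraNneq p0 => q0; rewrite eq q0 mul0r.
  move: np; rewrite eq size_Mmonic ?monic_prod_XsubC // size_prod_XsubC rsn.
  by rewrite addnS /= -[X in (X < _)%N]add0n; case: (size q) => [|[|m]] //; lia.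
have [alpha ra] := F_closed q q1.
have rpa : root p alpha by rewrite eq rootM ra.
exists (alpha :: rs); rewrite /= rsn rpa rsU rsp; split=> //; rewrite andbT.
apply/negP => alphars; have := simple alpha rpa; rewrite eq derivM.
have r_prod : root (\prod_(z <- rs) ('X - z%:P)) alpha by rewrite root_prod_XsubC.
by rewrite rootE hornerD !hornerM (rootP ra) (rootP r_prod) mulr0 mul0r addr0 eqxx.
Qed.

Lemma diff_generated_of_finitely (F : fieldType) (A : comNzRingType) (iA : F -> A)
    (dA : A -> A) :
  diff_finitely_generated iA dA -> exists xs, diff_generated iA dA xs.
Proof.
move=> [n [x Hx]]; exists (codom x) => P subP iP xP s; apply: Hx => // i k.
by apply: xP; exact: codom_f.
Qed.

Theorem theorem2
  (F : fieldType) (dF : F -> F)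
  (F_diff : is_derivation dF)
  (F_char0 : [pchar F] =i pred0)
  (F_closed : differentially_closed dF)
  (S : idomainType) (iS : {rmorphism F -> S}) (dS : S -> S)
  (S_diff : is_diff_algebra dF iS dS)
  (S_fg : diff_finitely_generated iS dS)
  (P : pred S) (R : subIdomainType P) (iR : {rmorphism F -> R}) (dR : R -> R)
  (R_diff : is_diff_algebra dF iR dR)
  (R_sub : is_diff_alg_hom iR dR iS dS (val : R -> S))
  (R_fg : diff_finitely_generated iR dR)
  (b : S) (b_neq0 : b != 0) :
  ((forall phi : R -> F, is_diff_alg_hom iR dR id dF phi ->
      finite_set (extensions dF iS dS b phi)) ->
    finite_extension (fract_incl R)) /\
  (forall d : nat,
    (forall phi : R -> F, is_diff_alg_hom iR dR id dF phi ->
      (extensions dF iS dS b phi #<= `I_d)%card) ->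
    ext_degree_le (fract_incl R) d).
Proof.
pose j : {rmorphism R -> S} := val.
have [dS_der iS_diff] := S_diff; have [dR_der iR_diff] := R_diff.
have [_ _ j_alg j_diff] := R_sub.
have j_inj : injective j by exact: val_inj.
have S_char0 : [pchar S] =i pred0 by move=> p; rewrite (fmorph_pchar iS).
have R_char0 : [pchar R] =i pred0 by move=> p; rewrite (fmorph_pchar iR).
have [xs gen] : exists xs, diff_generated j dS xs.
  have [xs gen] := diff_generated_of_finitely S_fg; exists xs => Q subQ jQ xsQ.
  by apply: gen => // a; rewrite -j_alg; exact: jQ.
(* The extension theorem over F itself provides points of R off any hypersurface. *)
have points a : a != 0 -> exists phi : {rmorphism R -> F},
    [/\ is_diff_alg_hom iR dR id dF phi, diff_hom dR dF phi & phi a != 0].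
  have [ys genR] := diff_generated_of_finitely R_fg.
  move=> a0; have [c c0 Hc] := differential_extension F_diff F_closed dR_der
    iR_diff (fmorph_inj iR) R_char0 genR a0.
  have [phi [phi_diff phi_alg phia]] := Hc idfun (fun=> erefl) c0.
  exists phi; split=> //; split=> //; first exact: rmorphB.
  by split; [exact: rmorph1|exact: rmorphM].
(* Non-vanishing of c at alpha lets the point z |-> alpha of R{z} extend to S,
   with b not sent to 0. *)
have lift z : exists2 c, diff_eval_at dS j z c != 0 &
    forall (phi : {rmorphism R -> F}) alpha,
    is_diff_alg_hom iR dR id dF phi -> diff_hom dR dF phi ->
    specializes (diff_eval_at dS j z) (diff_eval_at dF phi alpha) ->
    diff_eval_at dF phi alpha c != 0 ->
  exists2 psi, extensions dF iS dS b phi psi & psi z = alpha.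
  have [|c c0 Hc] := @extension_of_point F dF F_diff R dR S dS j z dS_der j_diff b.
    apply: (@differential_extension F dF F_diff F_closed S dS xs _
      (adjoined_der dS_der j_diff) (adjoined_incl dS j z)) => //.
    move=> Q subQ jQ xsQ; apply: gen => // a.
    have [y ey] := adjoined_incl_surj dS j z a%:DP.
    by rewrite -(diff_eval_at_const dS j z) -ey; exact: jQ.
  exists c => // phi alpha [_ _ phi_alg _] phi_diff sp ca.
  have [psi [psi_diff psi_ext psi_z psi_b]] := Hc phi alpha phi_diff sp ca.
  exists psi => //; split=> //; split=> //; first exact: rmorphB.
    by split; [exact: rmorph1|exact: rmorphM].
  by move=> a; rewrite -j_alg psi_ext phi_alg.
have algebraic : (forall phi : R -> F, is_diff_alg_hom iR dR id dF phi ->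
      finite_set (extensions dF iS dS b phi)) ->
    forall x, exists2 B : {poly R}, B != 0 & root (map_poly j B) x.
  move=> fin x; apply: contrapT => x_tr; have [c c0 Hc] := lift x.
  have [|a a0 Ha] :=
    transcendental_specializations F_diff F_closed dS_der j_diff j_inj S_char0 _ c0.
    by move=> B rB; apply/eqP; apply: contrapT => B0; apply: x_tr; exists B => //; exact/negP.
  have [phi [phi_alg phi_diff phia]] := points a a0.
  have /finite_seqP[s es] := finite_image (fun psi => psi x) (fin phi phi_alg).
  have [alpha [alphas sp ca]] := Ha phi phi_diff phia s.
  have [psi psi_ext psix] := Hc phi alpha phi_alg phi_diff sp ca.
  case/negP: alphas; suff : [set` s]%classic alpha by [].
  by rewrite -es; exists psi.
(* The primitive element z generates all of S, since the elements of S in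
   Fract R (z) are closed under dS. *)
have main : (forall phi : R -> F, is_diff_alg_hom iR dR id dF phi ->
      finite_set (extensions dF iS dS b phi)) ->
    exists z, exists2 A, min_annihilator j z A &
      has_ext_degree (fract_incl R) (size A).-1.
  move=> /algebraic alg; have [z zxs] := primitive_generator R_char0 xs alg.
  have [B B0 rB] := alg z; have [A Amin] := exists_min_annihilator B0 rB.
  exists z, A => //; apply: (hull_ext_degree Amin).
  apply: gen.
  - exact: hull_subring.
  - by move=> a; exact: hull_incl.
  - move=> x xxs; elim=> [|k IH]; first exact: zxs.
    exact: (hull_der dS_der j_diff Amin S_char0 IH).
split=> [/main[z [A _ degA]]|d card_ext]; first by exists (size A).-1.
have [|z [A Amin degA]] := main.
  by move=> phi /card_ext; move/card_le_finite; apply; exact: finite_II.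
exists (size A).-1 => //.
have [c c0 Hc] := lift z.
have [a a0 Ha] := algebraic_specializations F_diff dS_der j_diff j_inj S_char0 Amin c0.
have [phi [phi_alg phi_diff phia]] := points a a0.
have [lA H] := Ha phi phi_diff phia.
have sA : size (map_poly phi A) = size A by rewrite size_map_poly_id0.
have [|||rs [rsU rsA rsn]] := @simple_roots F (map_poly phi A).
- exact: closed_root F_closed.
- by rewrite -size_poly_gt0 sA; exact: ltnW (min_annihilator_size_gt1 j_inj Amin).
- by move=> alpha /H[]; rewrite deriv_map.
have psiP (i : nat) : exists psi, (i < size rs)%N ->
    extensions dF iS dS b phi psi /\ psi z = rs`_i.
  have [irs|_] := ltnP i (size rs); last by exists (fun=> 0).
  have [_ sp ca] := H _ (allP rsA _ (mem_nth 0 irs)).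
  by have [psi] := Hc phi _ phi_alg phi_diff sp ca; exists psi.
have [psi psiE] := choice psiP.
have psi_inj : {in `I_(size rs) &, injective psi}%classic.
  move=> i k; rewrite !inE => irs krs psi_ik.
  have [_ ei] := psiE i irs; have [_ ek] := psiE k krs.
  by apply/eqP; rewrite -(nth_uniq 0 irs krs rsU) -ei -ek psi_ik.
rewrite -sA -rsn -card_le_II -(card_le_eql (inj_card_eq psi_inj)).
apply: card_le_trans (card_ext phi phi_alg); apply: subset_card_le.
by move=> _ [i irs <-]; have [] := psiE i irs.
Qed.
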